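(* Let $\Phi$ be an aperiodic graphing on a standard probability space $(X,\mu)$. Then the closure $\overline{D([\Phi]_1)}$ in $[\Phi]_1$ of the derived group of $[\Phi]_1$ is topologically generated by involutions, i.e. it is the closure in $[\Phi]_1$ of the subgroup generated by the involutions of $[\Phi]_1$.
   Context: A standard probability space $(X,\mu)$ is a standard Borel space with a non-atomic Borel probability measure; everything is up to null sets. $\mathrm{Aut}(X,\mu)$ is the group of measure-preserving Borel bijections of $X$ modulo a.e. equality. A partial isomorphism is a measure-preserving Borel bijection $\varphi:\mathrm{dom}\,\varphi\to\mathrm{rng}\,\varphi$ between Borel subsets of $X$. A graphing $\Phi$ is a countable set of partial isomorphisms; it generates the equivalence relation $\mathcal R_\Phi$, the smallest one containing all $(x,\varphi(x))$ with $\varphi\in\Phi$, $x\in\mathrm{dom}\,\varphi$. $\Phi$ is aperiodic if almost every $\mathcal R_\Phi$-class is infinite. On $\mathcal R_\Phi$-classes put $d_\Phi(x,y)=\min\{n:\exists\varphi_1,\dots,\varphi_n\in\Phi\cup\Phi^{-1},\ y=\varphi_n\cdots\varphi_1(x)\}$. The full group is $[\mathcal R_\Phi]=\{T\in\mathrm{Aut}(X,\mu):(x,T(x))\in\mathcal R_\Phi\text{ a.e.}\}$ and the $\mathrm L^1$ full group is $[\Phi]_1=\{T\in[\mathcal R_\Phi]:\int_Xd_\Phi(x,T(x))\,d\mu<+\infty\}$, with the topology induced by the metric $\tilde d_\Phi(S,T)=\int_Xd_\Phi(S(x),T(x))\,d\mu(x)$. $D(G)$ denotes the derived subgroup of $G$.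 An involution is an element $U$ with $U^2=\mathrm{id}_X$. *)

(* Defs.v *)
From Stdlib Require Export Relation_Operators.
From HB Require Export structures.
From mathcomp Require Export all_boot all_order all_algebra.
From mathcomp Require Export all_classical all_reals all_analysis.

Set Implicit Arguments.
Unset Strict Implicit.
Unset Printing Implicit Defensive.

Import Order.TTheory GRing.Theory Num.Theory.

Local Open Scope classical_set_scope.
Local Open Scope ring_scope.

Definition separable_space (Y : topologicalType) : Prop :=
  exists2 D : set Y, countable D & dense D.

(* T is isomorphic, as a measurable space, to a Polish space with its Borel
   sigma-algebra: a Hausdorff complete pseudometric is a complete metric. *)
Definition standard_borel (R : realType) (d : measure_display)
    (T : measurableType d) : Prop :=
  exists (Y : completePseudoMetricType R) (f : T -> Y),
    [/\ hausdorff_space Y, separable_space Y, bijective f &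
        forall A : set T, measurable A <->
          exists2 B : set Y, <<s open >> B & A = f @^-1` B].

Definition nonatomic (R : realType) (d : measure_display)
    (T : measurableType d) (mu : probability T R) : Prop :=
  ~ exists A : set T, [/\ measurable A, (0 < mu A)%E &
      forall B : set T, measurable B -> B `<=` A -> mu B = 0%E \/ mu B = mu A].

Definition standard_probability_space (R : realType) (d : measure_display)
    (T : measurableType d) (mu : probability T R) : Prop :=
  standard_borel R T /\ nonatomic mu.

(* Elements of Aut(X, mu) are handled through representatives: genuine
   measure-preserving Borel bijections of X. All the sets of automorphisms
   considered below are saturated under a.e. equality, so that they are the
   preimages of the corresponding subsets of the quotient group. *)
Record aut (R : realType) (d : measure_display) (T : measurableType d)
    (mu : probability T R) := Aut {
  aut_fun :> T -> T ;
  aut_ifun : T -> T ;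
  aut_funK : cancel aut_fun aut_ifun ;
  aut_ifunK : cancel aut_ifun aut_fun ;
  measurable_aut_fun : measurable_fun setT aut_fun ;
  measurable_aut_ifun : measurable_fun setT aut_ifun ;
  aut_preserving : forall A, measurable A -> mu (aut_fun @^-1` A) = mu A }.

Section aut_group.
Context {R : realType} {d : measure_display} {T : measurableType d}.
Context {mu : probability T R}.
Implicit Types S U : aut mu.

Definition aut_id : aut mu.
Proof.
by apply: (@Aut _ _ _ mu idfun idfun) => //; exact: measurable_id.
Defined.

Definition aut_inv S : aut mu.
Proof.
apply: (@Aut _ _ _ mu (aut_ifun S) S).
- exact: aut_ifunK.
- exact: aut_funK.
- exact: measurable_aut_ifun.
- exact: measurable_aut_fun.
- move=> A mA; rewrite -(aut_preserving S); last first.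
    by rewrite -[X in measurable X]setTI; exact: measurable_aut_ifun.
  by congr (mu _); apply/seteqP; split => x /=; rewrite aut_funK.
Defined.

Definition aut_comp S U : aut mu.
Proof.
apply: (@Aut _ _ _ mu (S \o U) (aut_ifun U \o aut_ifun S)).
- by move=> x /=; rewrite !aut_funK.
- by move=> x /=; rewrite !aut_ifunK.
- exact: measurableT_comp (measurable_aut_fun S) (measurable_aut_fun U).
- exact: measurableT_comp (measurable_aut_ifun U) (measurable_aut_ifun S).
- move=> A mA; rewrite comp_preimage aut_preserving ?aut_preserving//.
  by rewrite -[X in measurable X]setTI; exact: measurable_aut_fun.
Defined.

Definition aut_eq S U : Prop := {ae mu, forall x, S x = U x}.

Definition aut_comm S U : aut mu :=
  aut_comp (aut_comp S U) (aut_comp (aut_inv S) (aut_inv U)).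

Definition aut_subgroup (G : set (aut mu)) : Prop :=
  [/\ G aut_id,
      (forall S U, G S -> G U -> G (aut_comp S U)),
      (forall S, G S -> G (aut_inv S)) &
      (forall S U, aut_eq S U -> G S -> G U)].

Definition aut_generated (A : set (aut mu)) : set (aut mu) :=
  smallest aut_subgroup A.

Definition aut_derived (G : set (aut mu)) : set (aut mu) :=
  aut_generated [set W | exists S U, [/\ G S, G U & W = aut_comm S U]].

End aut_group.

(* The values of pi_fun outside pi_dom are irrelevant. A Borel bijection
   between Borel subsets of a standard Borel space has a Borel inverse, which
   is the meaning of measurable_pi_image. *)
Record partial_iso (R : realType) (d : measure_display)
    (T : measurableType d) (mu : probability T R) := PartialIso {
  pi_fun :> T -> T ;
  pi_dom : set T ;
  pi_rng : set T ;
  measurable_pi_dom : measurable pi_dom ;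
  measurable_pi_rng : measurable pi_rng ;
  pi_bij : set_bij pi_dom pi_rng pi_fun ;
  measurable_pi_fun : measurable_fun pi_dom pi_fun ;
  measurable_pi_image : forall A, measurable A -> A `<=` pi_dom ->
    measurable (pi_fun @` A) ;
  pi_preserving : forall A, measurable A -> A `<=` pi_dom ->
    mu (pi_fun @` A) = mu A }.

Section graphing.
Context {R : realType} {d : measure_display} {T : measurableType d}.
Context {mu : probability T R}.
Variable Phi : set (partial_iso mu).

Definition graphing : Prop := countable Phi.

Definition graphing_edge (x y : T) : Prop :=
  exists2 phi : partial_iso mu, Phi phi & pi_dom phi x /\ y = phi x.

Definition graphing_rel : T -> T -> Prop := clos_refl_sym_trans T graphing_edge.

Definition aperiodic : Prop :=
  {ae mu, forall x, infinite_set [set y | graphing_rel x y]}.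

Fixpoint graphing_path (n : nat) (x y : T) : Prop :=
  if n is m.+1 then
    exists2 z, graphing_edge x z \/ graphing_edge z x & graphing_path m z y
  else x = y.

(* The value is +oo when x and y are not in the same class. *)
Definition graphing_dist (x y : T) : \bar R :=
  ereal_inf [set n%:R%:E | n in [set n | graphing_path n x y]].

Definition full_group : set (aut mu) :=
  [set S | {ae mu, forall x, graphing_rel x (S x)}].

Definition L1_full_group : set (aut mu) :=
  [set S | full_group S /\ (\int[mu]_x graphing_dist x (S x) < +oo)%E].

Definition L1_dist (S U : aut mu) : \bar R :=
  (\int[mu]_x graphing_dist (S x) (U x))%E.

(* Closure in the L1 full group, for the topology of the metric L1_dist. *)
Definition L1_closure (A : set (aut mu)) : set (aut mu) :=
  [set S | L1_full_group S /\ forall e : R, 0 < e ->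
    exists2 U, A U & (L1_dist S U < e%:E)%E].

Definition L1_involutions : set (aut mu) :=
  [set U | L1_full_group U /\ aut_eq (aut_comp U U) aut_id].

End graphing.

(* Main.v *)
Require Import Defs.
From mathcomp Require Import lra measurable_realfun zify.

(** Let [G] be the L1 full group, [N] the subgroup generated by its involutions
and [D] its derived subgroup.  Both groups are shown to have the same closure
by proving that [D] is contained in [N], and [N] in the closure of [D].

_Commutators are products of involutions_ ([L1_comm]).  Three facts give this
without any limit.

- For [S] in [G] and [Y] measurable, there is an involution [V] in [G] such
  that [V \o S] preserves [Y] up to a null set ([first_exit_swap]): [V] sends
  the points at which an [S]-orbit leaves [Y] to the points at which it first
  comes back to [Y].  By Poincare recurrence almost every orbit does come back.
  The displacement of [V] is at most the sum of the displacements of [S] along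
  an excursion out of [Y]; distinct excursions are disjoint, so that its
  integral is at most that of [S], as in the lemma of Kac.  Hence, up to null
  sets, [S = V \o S1 \o S2] with [S1] supported in [Y] and [S2] in its complement
  ([L1_split]).
- If [U] is supported in a set [C] disjoint from its image under [S], the
  involution [V] that exchanges [C] and that image through [S] conjugates [U]
  like [S] does, so that [S U S^-1 U^-1 = V (U V U^-1)] is a product of two
  involutions ([comm_displaced]).
- The support of [S] is covered by [Y] and its images under [S] and [S^-1],
  where [Y] is a maximal set disjoint from its image ([maximal_independent]).

Splitting [U] along these three sets writes it as a product of involutions, of
three elements displaced by [S], and of one element supported on the fixed
points of [S], which commutes with [S].  Since [N] is normal in [G], the
commutator of [S] and [U] belongs to [N].

_Involutions are limits of products of commutators_
([involution_in_closure]).  Let [U] be an involution of [G] and [Y] a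
fundamental domain of its restriction to its support.  The equivalence relation
is the orbit relation of a countable group of automorphisms of bounded
displacement, generated by involutions each of which exchanges part of the
domain of some element of [Phi] with its image ([generating_involutions]).  If
[g] is in this group and [C], [g C] are disjoint subsets of [Y], then [U]
restricted to the orbits of [C] and [g C] is the commutator of [U] restricted
to the orbits of [C] and of the involution that exchanges [C] with [g C] and
[U C] with [U g C] ([swaps_commutator]).  Matching greedily the points of [Y]
by such pieces leaves over a set that meets each class at most once, which is
null because the classes are infinite ([partial_transversal_null]).  So [U] is
the limit of its restrictions to the matched parts, which are in [D].

The closure of a subgroup is a subgroup ([L1_closure_subgroup]), so the closure
of [D] contains that of [N].

Measurability of the distance comes from the countable group as well: the
distance from [x] to [y] is at most [n] when a word of length at most [n] in
the generating involutions sends [x] to [y] ([path_word], [word_dist]). *)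

Set Implicit Arguments.
Unset Strict Implicit.
Unset Printing Implicit Defensive.

Import Order.TTheory GRing.Theory Num.Theory.
Import numFieldNormedType.Exports.

Local Open Scope classical_set_scope.
Local Open Scope ring_scope.

(** * Automorphisms glued from partial isomorphisms *)

(** The inverse images of the interiors of the balls of radius [1/(n+1)] around
    a countable dense set.  The balls whose center has code [i] under an
    injection of that set into [nat] are gathered in a union, which avoids
    choosing an enumeration of the set. *)
Lemma separating_sets (R : realType) d (T : measurableType d) :
  standard_borel R T ->
  exists2 B : nat -> set T, forall k, measurable (B k) &
    forall x y, x <> y -> exists k, B k x /\ ~ B k y.
Proof.
move=> [Y [f [hY [D cD dD] [g fK gK] mT]]].
have /countable_injP[h hI] := cD.
pose O i n : set Y :=
  \bigcup_(a in D `&` [set a | h a = i]) (ball a (n.+1%:R^-1 : R))°.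
pose B k := if choice.unpickle k is Some (i, n) then f @^-1` (O i n) else set0.
exists B => [k|x y xy].
  rewrite /B; case: choice.unpickle => [[i n]|//].
  apply/mT; exists (O i n) => //; apply: sub_sigma_algebra.
  by apply: bigcup_open => a _; exact: open_interior.
have fxy : f x != f y by apply/eqP => /(can_inj fK).
move: (hY); rewrite ball_hausdorff => /(_ _ _ fxy)[[r s] /= /eqP rs0].
set e := Num.min r%:num s%:num.
have e0 : 0 < e by rewrite lt_min !gt0.
pose n := Num.truncn (2 / e); pose q : R := n.+1%:R^-1.
have q0 : 0 < q by rewrite invr_gt0.
have qe : q < e / 2.
  rewrite /q -[ltRHS]invrK ltf_pV2 ?posrE ?invr_gt0 ?divr_gt0//.
  by rewrite invfM invrK mulrC; exact: truncnS_gt.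
have [a [fa Da]] : (ball (f x) (q / 2))° `&` D !=set0.
  apply: dD; last exact: open_interior.
  exists (f x); rewrite /interior /=; exact/nbhsx_ballx/divr_gt0.
have {}fa := interior_subset fa.
exists (choice.pickle (h a, n)); rewrite /B choice.pickleK; split.
  exists a => //; apply/nbhs_ballP; exists (q / 2); first exact: divr_gt0.
  move=> z xz; rewrite -/q [q]splitr; apply: ball_triangle xz.
  exact: ball_sym.
move=> [b [Db hb]] /interior_subset; rewrite -/q.
have -> : b = a by apply: hI; rewrite ?inE.
move=> ay; suff : set0 (f y) by [].
rewrite -rs0; split; last exact: ballxx.
apply: (@le_ball _ _ _ (q / 2 + q)); last exact: ball_triangle fa ay.
have : r%:num >= e by rewrite ge_min lexx.
by apply: le_trans; lra.
Qed.

Section aut_basics.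
Context {R : realType} {d : measure_display} {T : measurableType d}.
Context {mu : probability T R}.
Implicit Types (S U V : aut mu) (A B C : set T).

Lemma aut_inj S : injective S.
Proof. exact: can_inj (aut_funK S). Qed.

Lemma measurable_preimage (f : T -> T) A :
  measurable_fun setT f -> measurable A -> measurable (f @^-1` A).
Proof. by move=> mf mA; rewrite -[X in measurable X]setTI; exact: mf. Qed.

Lemma measurable_aut_preimage S A : measurable A -> measurable (S @^-1` A).
Proof. exact/measurable_preimage/measurable_aut_fun. Qed.

Lemma aut_image S A : S @` A = aut_inv S @^-1` A.
Proof.
apply/seteqP; split => [_ [x Ax <-]|x Ax] /=; first by rewrite aut_funK.
by exists (aut_inv S x) => //; exact: aut_ifunK.
Qed.

Lemma measurable_aut_image S A : measurable A -> measurable (S @` A).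
Proof. by rewrite aut_image; exact: measurable_aut_preimage. Qed.

Lemma measure_aut_image S A : measurable A -> mu (S @` A) = mu A.
Proof. by move=> mA; rewrite aut_image aut_preserving. Qed.

Lemma ae_aut S (P : T -> Prop) :
  {ae mu, forall x, P x} -> {ae mu, forall x, P (S x)}.
Proof.
move=> [N [mN N0 PN]]; exists (S @^-1` N); split.
- exact: measurable_aut_preimage.
- by rewrite aut_preserving.
- by move=> x /= Px; exact: PN.
Qed.

Lemma integral_aut S (f : T -> \bar R) : measurable_fun setT f ->
  (forall x, 0 <= f x)%E -> (\int[mu]_x f (S x) = \int[mu]_x f x)%E.
Proof.
move=> mf f0.
transitivity (\int[pushforward mu S]_x f x)%E.
  rewrite ge0_integral_pushforward//; exact: measurable_aut_fun.
by apply: eq_measure_integral => [|mS A mA _];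
  [exact: measurable_aut_fun|exact: aut_preserving].
Qed.

Definition aut_iter S n : aut mu := iter n (aut_comp S) aut_id.

Lemma aut_iterE S n x : aut_iter S n x = iter n S x.
Proof. by elim: n x => //= n IHn x; rewrite IHn. Qed.

Lemma measurable_iter S n : measurable_fun setT (iter n S).
Proof.
rewrite (_ : iter n S = aut_iter S n); first exact: measurable_aut_fun.
by apply/funext => x; rewrite aut_iterE.
Qed.

Lemma iter_inj S n : injective (iter n S).
Proof. by move=> x y; rewrite -!aut_iterE => /aut_inj. Qed.

Definition pi_of_aut S C (mC : measurable C) : partial_iso mu.
Proof.
apply: (@PartialIso _ _ _ mu S C (S @` C)) => //.
- exact: measurable_aut_image.
- split=> //; last by apply: in2W; exact: aut_inj.
- exact: measurable_funTS (measurable_aut_fun S).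
- by move=> A mA _; exact: measurable_aut_image.
- by move=> A mA _; exact: measure_aut_image.
Defined.

Definition pi_restrict (phi : partial_iso mu) C (mC : measurable C) :
  partial_iso mu.
Proof.
move: (measurable_pi_dom phi) (@subIsetl _ (pi_dom phi) C) => mD DC.
apply: (@PartialIso _ _ _ mu phi (pi_dom phi `&` C) (phi @` (pi_dom phi `&` C))).
- exact: measurableI.
- by apply: measurable_pi_image => //; exact: measurableI.
- split=> // x y; rewrite !inE => -[Dx _] [Dy _].
  by apply: set_bij_inj; [exact: pi_bij|rewrite inE|rewrite inE].
- exact: (measurable_funS mD DC (@measurable_pi_fun _ _ _ _ phi)).
- by move=> A mA AD; exact: (measurable_pi_image mA (subset_trans AD DC)).
- by move=> A mA AD; exact: (pi_preserving mA (subset_trans AD DC)).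
Defined.

Lemma pi_inj (phi : partial_iso mu) x y :
  pi_dom phi x -> pi_dom phi y -> phi x = phi y -> x = y.
Proof. by move=> Dx Dy; apply: set_bij_inj; [exact: pi_bij|rewrite inE|rewrite inE]. Qed.

Lemma pi_rngE (phi : partial_iso mu) : pi_rng phi = phi @` pi_dom phi.
Proof.
have [homo _ surj] := pi_bij phi.
by apply/esym/surj_image_eq => // _ [x Dx <-]; exact: homo.
Qed.

Section swap_family.
Variable phi : nat -> partial_iso mu.
Hypothesis dom_disj : forall i j x,
  pi_dom (phi i) x -> pi_dom (phi j) x -> i = j.
Hypothesis rng_disj : forall i j x,
  pi_rng (phi i) x -> pi_rng (phi j) x -> i = j.
Hypothesis dom_rng_disj : forall i j x,
  pi_dom (phi i) x -> ~ pi_rng (phi j) x.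

Let fwd x y := exists2 n, pi_dom (phi n) x & y = phi n x.

Let in_rng n x : pi_dom (phi n) x -> pi_rng (phi n) (phi n x).
Proof. by move=> Dx; rewrite pi_rngE; exists x. Qed.

Let swapped x y :=
  fwd x y \/ fwd y x \/ (x = y /\ forall z, ~ fwd x z /\ ~ fwd z x).

Let swappedC x y : swapped x y -> swapped y x.
Proof. by move=> [|[|[-> ?]]]; [right; left|left|right; right]. Qed.

Let swapped_total x : exists y, swapped x y.
Proof.
have [[y ?]|nx] := pselect (exists y, fwd x y); first by exists y; left.
have [[y ?]|ny] := pselect (exists y, fwd y x); first by exists y; right; left.
exists x; right; right; split=> // z; split=> ?; [apply: nx|apply: ny];
  by exists z.
Qed.

Let fwd_fwd x y z : fwd x y -> fwd y z -> False.
Proof.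
move=> [i Dx ->] [j Dy _]; apply: (@dom_rng_disj j i (phi i x)) => //.
exact: in_rng.
Qed.

Let swapped_fun x y z : swapped x y -> swapped x z -> y = z.
Proof.
move=> [xy|[yx|[<- nx]]] [xz|[zx|[<- nx']]] //.
- by case: xy xz => i Di -> [j Dj ->]; rewrite (dom_disj Di Dj).
- by case: (fwd_fwd zx xy).
- by case: (nx' y) => /(_ xy).
- by case: (fwd_fwd yx xz).
- case: yx zx => i Di xi [j Dj xj].
  have ij : i = j by apply: (@rng_disj _ _ x); [rewrite xi|rewrite xj]; apply: in_rng.
  by subst j; apply: pi_inj Di Dj _; rewrite -xi.
- by case: (nx' y) => _ /(_ yx).
- by case: (nx z) => /(_ xz).
- by case: (nx z) => _ /(_ zx).
Qed.

(** The involutions of the proof come from here, directly or by conjugation.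
    Being equal to [phi n] or
    to its inverse on each of countably many disjoint pieces, and to the
    identity elsewhere, [V] preserves the measure because the pieces
    [pi_dom (phi n)] and [pi_rng (phi n)] exchange their contents. *)
Lemma swap_family : exists2 V : aut mu, (forall x, V (V x) = x) &
  [/\ forall n x, pi_dom (phi n) x -> V x = phi n x,
      forall n x, pi_dom (phi n) x -> V (phi n x) = x &
      forall x, (forall n, ~ pi_dom (phi n) x /\ ~ pi_rng (phi n) x) ->
        V x = x].
Proof.
have [V VP] := choice swapped_total.
have VK x : V (V x) = x by apply: swapped_fun (VP _) _; exact/swappedC/VP.
have Vd n x : pi_dom (phi n) x -> V x = phi n x.
  by move=> Dx; apply: swapped_fun (VP _) _; left; exists n.
have Vr n x : pi_dom (phi n) x -> V (phi n x) = x.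
  by move=> Dx; apply: swapped_fun (VP _) _; right; left; exists n.
have Vo x : (forall n, ~ pi_dom (phi n) x /\ ~ pi_rng (phi n) x) -> V x = x.
  move=> nx; apply: swapped_fun (VP _) _; right; right; split=> // z.
  split=> -[n Dz ?]; have [n1 n2] := nx n; [exact: n1|].
  by apply: n2; subst x; exact: in_rng.
pose D := \bigcup_n pi_dom (phi n).
pose E := \bigcup_n pi_rng (phi n).
pose F n A := pi_dom (phi n) `&` phi n @^-1` A.
pose G n A := phi n @` (pi_dom (phi n) `&` A).
have mdom n : measurable (pi_dom (phi n)) by exact: measurable_pi_dom.
have mF n A : measurable A -> measurable (F n A).
  by move=> mA; exact: measurable_pi_fun.
have mdomI n A : measurable A -> measurable (pi_dom (phi n) `&` A).
  by move=> mA; exact: measurableI.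
have mG n A : measurable A -> measurable (G n A).
  by move=> mA; apply: measurable_pi_image; [exact: mdomI|move=> x []].
have mD : measurable D by exact: bigcupT_measurable.
have mE : measurable E.
  by apply: bigcupT_measurable => n; exact: measurable_pi_rng.
have VD A : V @^-1` A `&` D = \bigcup_n F n A.
  apply/seteqP; split => [x [/= Ax [n _ Dx]]|x [n _ [Dx Ax]]].
    by exists n => //; split=> //=; rewrite -(Vd _ _ Dx).
  by split; [rewrite /= (Vd _ _ Dx)|exists n].
have VE A : V @^-1` A `&` E = \bigcup_n G n A.
  apply/seteqP; split => [x [/= Ax [n _]]|x [n _ [y [Dy Ay] <-]]].
    rewrite pi_rngE => -[y Dy yx]; exists n => //; exists y => //; split=> //.
    by move: Ax; rewrite -yx (Vr _ _ Dy).
  by split; [rewrite /= (Vr _ _ Dy)|exists n => //; exact: in_rng].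
have VO A : V @^-1` A `\` (D `|` E) = A `\` (D `|` E).
  have h x : ~ (D `|` E) x -> V x = x.
    move=> nx; apply: Vo => n; split=> ?; apply: nx; [left|right]; by exists n.
  by apply/seteqP; split => x [/= Ax nx]; split => //=;
    [rewrite -(h _ nx)|rewrite (h _ nx)].
have splitDE A : A = (A `&` D `|` A `&` E) `|` A `\` (D `|` E).
  by rewrite -setIUr setUIDK.
have DE0 : D `&` E = set0.
  by apply/seteqP; split => // x [[n _ Dx] [m _]]; exact: dom_rng_disj Dx.
have mV A : measurable A -> measurable (V @^-1` A).
  move=> mA; rewrite (splitDE (V @^-1` A)) VD VE VO.
  apply: measurableU; first apply: measurableU.
  - by apply: bigcupT_measurable => n; exact: mF.
  - by apply: bigcupT_measurable => n; exact: mG.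
  - by apply: measurableD => //; exact: measurableU.
have tF A : trivIset setT (F ^~ A).
  by apply/trivIsetP => i j _ _ /eqP ij; apply/seteqP; split=> // x
    [[Dx _] [Dy _]]; apply: ij; exact: dom_disj Dx Dy.
have muDE A : measurable A -> mu A = (mu (A `&` D) + mu (A `&` E)
    + mu (A `\` (D `|` E)))%E.
  move=> mA; rewrite {1}(splitDE A) measureU//.
  - congr (_ + _)%E; rewrite measureU//; [exact: measurableI|exact: measurableI|].
    by rewrite setIACA DE0 setI0.
  - by apply: measurableU; exact: measurableI.
  - by apply: measurableD => //; exact: measurableU.
  - by apply/seteqP; split=> // x [[[_ Dx]|[_ Ex]] [_ nx]]; apply: nx; [left|right].
have mVf : measurable_fun setT V by move=> _ A mA; rewrite setTI; exact: mV.
have Vpres A : measurable A -> mu (V @^-1` A) = mu A.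
  move=> mA; rewrite (muDE (V @^-1` A))//; last exact: mV.
  rewrite [RHS](muDE A)// VO; congr (_ + _)%E; rewrite addeC.
  (* V maps D onto E piece by piece, through the phi n *)
  have swapDE B : measurable B -> mu (V @^-1` B `&` D) = mu (B `&` E).
    move=> mB; rewrite VD measure_bigcup//; last by move=> *; exact: mF.
    transitivity (mu (\bigcup_n (phi n @` F n B))).
      rewrite measure_bigcup//.
      - apply: eq_eseriesr => n _. apply/esym/pi_preserving; [exact: mF|by move=> x []].
      - by move=> n _; apply: measurable_pi_image; [exact: mF|by move=> x []].
      - apply/trivIsetP => i j _ _ /eqP ij; apply/seteqP; split=> // x
          [[y [Dy _] yx] [z [Dz _] zx]]; apply: ij; apply: (@rng_disj _ _ x);
        by [rewrite -yx; exact: in_rng|rewrite -zx; exact: in_rng].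
    congr (mu _); apply/seteqP; split => [_ [n _ [x [Dx Bx] <-]]|x [Bx [n _]]].
      by split=> //; exists n => //; exact: in_rng.
    by rewrite pi_rngE => -[y Dy yx]; exists n => //; exists y => //; split;
      rewrite // /= yx.
  rewrite swapDE//; congr (_ + _)%E.
  have := swapDE _ (mV _ mA); rewrite -comp_preimage.
  by rewrite (_ : V \o V = id) ?preimage_id => [->//|]; apply/funext.
by exists (Aut VK VK mVf mVf Vpres).
Qed.
End swap_family.
End aut_basics.

(** * Generating involutions and the distance *)

Section generators.
Context {R : realType} {d : measure_display} {T : measurableType d}.
Context {mu : probability T R}.
Variable Phi : set (partial_iso mu).

Lemma swap_partial_iso (phi : partial_iso mu) :
  (forall x, pi_dom phi x -> ~ pi_rng phi x) ->
  exists V : aut mu, [/\ forall x, V (V x) = x,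
    forall x, pi_dom phi x -> V x = phi x &
    forall x, V x = x \/ (pi_dom phi x /\ V x = phi x) \/
      (pi_dom phi (V x) /\ x = phi (V x))].
Proof.
move=> dr.
pose phi0 := pi_restrict phi (@measurable0 _ T).
pose fam n := if n is 0 then phi else phi0.
have dom0 x : ~ pi_dom phi0 x by move=> [].
have rng0 x : ~ pi_rng phi0 x by move=> [y []].
have [||[|i] [|j] x|V VK [Vd Vr Vo]] := @swap_family _ _ _ mu fam.
- by move=> [|i] [|j] x // a b; case: (dom0 x).
- by move=> [|i] [|j] x // a b; case: (rng0 x).
- exact: dr.
- by move=> _ b; case: (rng0 x).
- by move=> a; case: (dom0 x).
- by move=> a; case: (dom0 x).
exists V; split=> // [x Dx|x]; first exact: (Vd 0%N).
have [Dx|nDx] := pselect (pi_dom phi x); first by right; left; rewrite (Vd 0%N).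
have [|nRx] := pselect (pi_rng phi x).
  rewrite pi_rngE => -[y Dy <-]; right; right.
  by have /= -> := Vr 0%N y Dy.
by left; apply: Vo => -[|n] /=; split=> //; [exact: dom0|exact: rng0].
Qed.

(** A partial isomorphism [phi] is cut into the pieces formed by the points [x]
    of [B k] with [phi x] outside [B k]: such a piece is disjoint from its
    image, so that it can be swapped with it, and these pieces cover the points
    moved by [phi]. *)
Lemma generating_involutions : standard_borel R T -> graphing Phi ->
  exists gen : nat -> aut mu,
    (forall i x, gen i x = x \/ graphing_edge Phi x (gen i x) \/
       graphing_edge Phi (gen i x) x) /\
    (forall x y, x <> y -> graphing_edge Phi x y ->
       exists i, gen i x = y /\ gen i y = x).
Proof.
move=> /separating_sets[B mB sepB] /countable_injP[h hI].
pose spec i (V : aut mu) := (forall x, V x = x \/ graphing_edge Phi x (V x) \/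
       graphing_edge Phi (V x) x) /\
  (forall phi k, Phi phi -> i = choice.pickle (h phi, k) ->
    forall x, pi_dom phi x -> B k x -> ~ B k (phi x) ->
      V x = phi x /\ V (phi x) = x).
have : forall i, exists V, spec i V.
  move=> i.
  have [[phi [k [Phiphi ik]]]|no] :=
    pselect (exists phi (k : nat), Phi phi /\ i = choice.pickle (h phi, k)); last first.
    exists aut_id; split=> [x|phi k Phiphi ik]; first by left.
    by case: no; exists phi, k.
  have mC : measurable (B k `&` (pi_dom phi `&` phi @^-1` ~` B k)).
    apply: measurableI => //; apply: measurable_pi_fun.
      exact: measurable_pi_dom.
    exact: measurableC.
  have [|V [VK Vd VE]] := @swap_partial_iso (pi_restrict phi mC).
    move=> x [_ [Bx _]] [y [_ [_ [_ nB]]] yx].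
    by apply: nB => /=; rewrite yx.
  exists V; split => [x|psi l Psipsi].
    have [->|[[[Dx _] ->]|[[Dx _] xE]]] := VE x; first by left.
      by right; left; exists phi.
    by right; right; exists phi.
  rewrite ik => /(pcan_inj choice.pickleK)[hh <-] {l} x Dx Bx nBx.
  have ? : psi = phi by apply: hI; rewrite ?inE.
  subst psi; have -> : V x = phi x by apply: Vd.
  by split=> //; rewrite -{2}(VK x) (Vd x).
move=> /choice[gen genP]; exists gen; split=> [i|x y xy]; first exact: (genP i).1.
move=> [phi Phiphi [Dx yE]]; have [k [Bx nBy]] := sepB _ _ xy; subst y.
by exists (choice.pickle (h phi, k)); apply: (genP _).2 _ _ Phiphi erefl x Dx Bx nBy.
Qed.

Local Notation dist := (graphing_dist Phi).

Lemma graphing_path_cat m n x y z :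
  graphing_path Phi m x y -> graphing_path Phi n y z ->
  graphing_path Phi (m + n) x z.
Proof.
elim: m x => [|m IHm] x /=; first by move->.
by move=> [w xw wy] yz; exists w => //; exact: IHm.
Qed.

Lemma graphing_path_sym n x y : graphing_path Phi n x y -> graphing_path Phi n y x.
Proof.
elim: n x => [//|n IHn] x [z xz /IHn zy].
suff : graphing_path Phi (n + 1) y x by rewrite addn1.
by apply: graphing_path_cat zy _; exists x => //; case: xz => ?; [right|left].
Qed.

Lemma graphing_relP x y :
  graphing_rel Phi x y <-> exists n, graphing_path Phi n x y.
Proof.
split=> [|[n]].
  elim=> {x y} [x y xy|x|x y _ [n /graphing_path_sym]|x y z _ [m xy] _ [n yz]].
  - by exists 1%N, y => //; left.
  - by exists 0%N.
  - by exists n.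
  - by exists (m + n)%N; exact: graphing_path_cat yz.
elim: n x => [x <-|n IHn x /= [z xz /IHn zy]]; first exact: rst_refl.
apply: rst_trans zy; case: xz => ?; first exact: rst_step.
by apply: rst_sym; exact: rst_step.
Qed.

Lemma dist_ge0 x y : (0 <= dist x y)%E.
Proof. by apply: le_ereal_inf_tmp => _ [n _ <-]; rewrite lee_fin. Qed.
Hint Resolve dist_ge0 : core.

Lemma dist_path n x y : graphing_path Phi n x y -> (dist x y <= n%:R%:E)%E.
Proof. by move=> xy; apply: ereal_inf_lbound; exists n. Qed.

(** In particular the distance takes its values in the natural numbers and
    infinity. *)
Lemma dist_attained x y : dist x y = +oo%E \/
  exists2 n, graphing_path Phi n x y & dist x y = n%:R%:E.
Proof.
have [[n xy]|no] := pselect (exists n, graphing_path Phi n x y); last first.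
  left; rewrite /graphing_dist (_ : [set _ | _ in _] = set0) ?ereal_inf0//.
  by apply/seteqP; split=> // z [n xy _]; apply: no; exists n.
right; have ex : exists n, `[< graphing_path Phi n x y >].
  by exists n; exact/asboolP.
have [m /asboolP xy' mmin] := ex_minnP ex; exists m => //.
apply/eqP; rewrite eq_le dist_path//=; apply: le_ereal_inf_tmp => _ [k xyk <-].
by rewrite lee_fin ler_nat; apply: mmin; exact/asboolP.
Qed.

Lemma dist_refl x : dist x x = 0%E.
Proof. by apply/eqP; rewrite eq_le dist_ge0 (@dist_path 0). Qed.

Lemma dist_sym x y : dist x y = dist y x.
Proof.
wlog: x y / (dist x y <= dist y x)%E => [h|].
  by have /orP[/h//|/h] := le_total (dist x y) (dist y x).
have [->|[n yx ->]] := dist_attained x y; first by rewrite leye_eq => /eqP.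
move=> le; apply/eqP; rewrite eq_le le /=; exact/dist_path/graphing_path_sym.
Qed.

Lemma dist_triangle y x z : (dist x z <= dist x y + dist y z)%E.
Proof.
have [->|[m xy ->]] := dist_attained x y; first by rewrite addye ?leey// gt_eqF// (lt_le_trans _ (dist_ge0 _ _)).
have [->|[n yz ->]] := dist_attained y z; first by rewrite addey ?leey.
by rewrite -EFinD -natrD; apply: dist_path; exact: graphing_path_cat yz.
Qed.

Lemma dist_ge1 x y : x <> y -> (1 <= dist x y)%E.
Proof.
by move=> xy; apply: le_ereal_inf_tmp => _ [[|n] // _ <-]; rewrite lee_fin ler1n.
Qed.

Lemma dist_lty x y : (dist x y < +oo)%E -> graphing_rel Phi x y.
Proof.
have [->//|[n xy _] _] := dist_attained x y; by apply/graphing_relP; exists n.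
Qed.

Variable gen : nat -> aut mu.
Hypothesis gen_edge : forall i x, gen i x = x \/
  graphing_edge Phi x (gen i x) \/ graphing_edge Phi (gen i x) x.
Hypothesis edge_gen : forall x y, x <> y -> graphing_edge Phi x y ->
  exists i, gen i x = y /\ gen i y = x.

Fixpoint word (w : seq nat) : aut mu :=
  if w is i :: v then aut_comp (word v) (gen i) else aut_id.

Lemma word_dist w x : (dist x (word w x) <= (size w)%:R%:E)%E.
Proof.
elim: w x => [|i w IHw] x /=; first by rewrite dist_refl.
apply: le_trans (dist_triangle (gen i x) _ _) _.
rewrite -add1n natrD EFinD; apply: leeD => //.
have [->|xi] := gen_edge i x; first by rewrite dist_refl.
by apply: (@dist_path 1); exists (gen i x).
Qed.

Lemma path_word n x y : graphing_path Phi n x y ->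
  exists2 w, (size w <= n)%N & word w x = y.
Proof.
elim: n x => [x ->|n IHn x [z xz /IHn[w wn wz]]]; first by exists [::].
have [xzE|xzN] := pselect (x = z); first by exists w; [exact: leqW|rewrite xzE].
have [i xi] : exists i, gen i x = z.
  case: xz => [/(edge_gen xzN)|/(edge_gen (not_eq_sym xzN))] [i []];
  by exists i.
by exists (i :: w) => //=; rewrite xi.
Qed.

Lemma rel_word x y : graphing_rel Phi x y -> exists w, word w x = y.
Proof. by move=> /graphing_relP[n /path_word[w _ wx]]; exists w. Qed.

Section measurability.
Variable B : nat -> set T.
Hypothesis mB : forall k, measurable (B k).
Hypothesis sepB : forall x y, x <> y -> exists k, B k x /\ ~ B k y.

Lemma measurable_eq_set (f g : T -> T) :
  measurable_fun setT f -> measurable_fun setT g ->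
  measurable [set x | f x = g x].
Proof.
move=> mf mg.
rewrite (_ : [set _ | _] = ~` \bigcup_k (f @^-1` B k `\` g @^-1` B k)).
  apply: measurableC; apply: bigcupT_measurable => k.
  by apply: measurableD; exact: measurable_preimage.
apply/seteqP; split => x /= => [fg [k _ []]|h]; first by rewrite /= fg.
apply: contrapT => /sepB[k [fx gx]]; apply: h; by exists k.
Qed.

Lemma measurable_dist (f g : T -> T) :
  measurable_fun setT f -> measurable_fun setT g ->
  measurable_fun setT (fun x => dist (f x) (g x)).
Proof.
move=> mf mg; apply: (measurability _ (ErealGenInftyO.measurableE R)) => _ [_ [r ->] <-].
rewrite setTI (_ : _ @^-1` _ =
    \bigcup_(w in [set w | (size w)%:R%:E < r%:E]%E) [set x | word w (f x) = g x]).
  rewrite bigcup_mkcond; apply: countable_bigcupT_measurable => [|w]; first exact: countableP.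
  case: ifP => _ //; apply: measurable_eq_set => //.
  exact: measurableT_comp (measurable_aut_fun (word w)) mf.
apply/seteqP; split => x /=; rewrite in_itv /=.
  have [->//|[n /path_word[w wn wx] ->]] := dist_attained (f x) (g x) => nr.
  by exists w => //; apply: (le_lt_trans _ nr); rewrite lee_fin ler_nat.
by move=> [w wr /= <-]; exact: le_lt_trans (word_dist _ _) wr.
Qed.
End measurability.
End generators.

(** * The L1 full group and its closures *)

Section subgroups.
Context {R : realType} {d : measure_display} {T : measurableType d}.
Context {mu : probability T R}.
Implicit Types (S U V W : aut mu) (G A : set (aut mu)).

Lemma aut_generated_sub A : A `<=` aut_generated A.
Proof. exact: sub_smallest. Qed.

Lemma aut_generated_subgroup A : aut_subgroup (aut_generated A).
Proof.
split.
- by move=> G [[]].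
- by move=> S U AS AU G GA; have [[_ GM _ _] _] := GA; apply: GM; [exact: AS|exact: AU].
- by move=> S AS G GA; have [[_ _ GV _] _] := GA; apply: GV; exact: AS.
- by move=> S U SU AS G GA; have [[_ _ _ GE] _] := GA; apply: GE SU _; exact: AS.
Qed.

Lemma aut_generated_min A G : aut_subgroup G -> A `<=` G -> aut_generated A `<=` G.
Proof. by move=> sG AG; exact: smallest_sub. Qed.

Lemma aut_eqW S U : (forall x, S x = U x) -> aut_eq S U.
Proof. by move=> SU; exact/aeW. Qed.

Lemma aut_eq_sym S U : aut_eq S U -> aut_eq U S.
Proof. by apply: filterS => x ->. Qed.

End subgroups.

Section L1.
Context {R : realType} {d : measure_display} {T : measurableType d}.
Context {mu : probability T R}.
Variable Phi : set (partial_iso mu).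
Implicit Types (S U V W : aut mu) (A : set (aut mu)) (E : set T).
Local Notation dist := (graphing_dist Phi).
Hypothesis mdist : forall f g : T -> T, measurable_fun setT f ->
  measurable_fun setT g -> measurable_fun setT (fun x => dist (f x) (g x)).
Hint Resolve dist_ge0 measurable_aut_fun : core.

Let mdistA S U : measurable_fun setT (fun x => dist (S x) (U x)).
Proof. exact: mdist. Qed.

Let mdist1 S : measurable_fun setT (fun x => dist x (S x)).
Proof. exact: mdistA aut_id S. Qed.

(** A function with finite integral is finite almost everywhere, so that the
    integrability of the displacement forces [S] into the full group. *)
Lemma L1_full_groupP S :
  L1_full_group Phi S <-> (\int[mu]_x dist x (S x) < +oo)%E.
Proof.
split=> [[]//|fin]; split=> //.
have : mu.-integrable setT (fun x => dist x (S x)).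
  apply/integrableP; split=> //.
  by under eq_integral do rewrite gee0_abs//.
move=> /integrable_ae => /(_ measurableT); apply: filterS => x /(_ I) xS.
by apply: dist_lty; rewrite ltey_eq xS.
Qed.

Lemma L1_full_group_dominated S (f : T -> \bar R) : measurable_fun setT f ->
  (\int[mu]_x f x < +oo)%E -> {ae mu, forall x, dist x (S x) <= f x}%E ->
  L1_full_group Phi S.
Proof.
move=> mf f_fin Sf; apply/L1_full_groupP; apply: le_lt_trans f_fin.
have f0 : {ae mu, forall x, 0 <= f x}%E.
  by apply: filterS Sf => x; exact: le_trans.
rewrite [leRHS](_ : _ = \int[mu]_x maxe 0 (f x))%E; last first.
  apply: ae_eq_integral => //; first by exact: measurable_maxe.
  by apply: filterS f0 => x f0 _; apply/esym/max_idPr.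
apply: ae_ge0_le_integral => //.
- by move=> x _; rewrite le_max lexx.
- exact: measurable_maxe.
- by apply: filterS Sf => x Sx _; rewrite le_max Sx orbT.
Qed.

Lemma L1_id : L1_full_group Phi aut_id.
Proof.
apply/L1_full_groupP; rewrite integral0_eq ?ltry// => x _; exact: dist_refl.
Qed.

Lemma L1_comp S U :
  L1_full_group Phi S -> L1_full_group Phi U -> L1_full_group Phi (aut_comp S U).
Proof.
move=> /L1_full_groupP S1 /L1_full_groupP U1.
apply: (@L1_full_group_dominated _ (fun x => dist x (U x) + dist (U x) (S (U x)))%E).
- by apply: emeasurable_funD => //; exact: (mdistA U (aut_comp S U)).
- rewrite ge0_integralD//; last exact: (mdistA U (aut_comp S U)).
  rewrite (@integral_aut _ _ _ _ U (fun y => dist y (S y)))//.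
  exact: lte_add_pinfty.
- by apply: aeW => x; exact: dist_triangle.
Qed.

Lemma L1_inv S : L1_full_group Phi S -> L1_full_group Phi (aut_inv S).
Proof.
move=> /L1_full_groupP S1; apply/L1_full_groupP.
rewrite -(@integral_aut _ _ _ _ S)//.
by under eq_integral do rewrite /= aut_funK dist_sym.
Qed.

Lemma L1_ae S U : aut_eq S U -> L1_full_group Phi S -> L1_full_group Phi U.
Proof.
move=> SU /L1_full_groupP S1.
by apply: L1_full_group_dominated (mdist1 S) S1 _; apply: filterS SU => x ->.
Qed.

Lemma L1_subgroup : aut_subgroup (L1_full_group Phi).
Proof.
split; [exact: L1_id|exact: L1_comp|exact: L1_inv|exact: L1_ae].
Qed.

Lemma L1_dist_triangle U S W :
  (L1_dist Phi S W <= L1_dist Phi S U + L1_dist Phi U W)%E.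
Proof.
rewrite /L1_dist -ge0_integralD//.
apply: ge0_le_integral => //; first exact: emeasurable_funD.
by move=> x _; exact: dist_triangle.
Qed.

Lemma L1_dist_sym S U : L1_dist Phi S U = L1_dist Phi U S.
Proof. by apply: eq_integral => x _; rewrite dist_sym. Qed.

Lemma L1_dist_refl S : L1_dist Phi S S = 0%E.
Proof. by apply: integral0_eq => x _; exact: dist_refl. Qed.

Lemma L1_dist_compr U S W :
  L1_dist Phi (aut_comp S U) (aut_comp W U) = L1_dist Phi S W.
Proof. exact: (@integral_aut _ _ _ _ U (fun y => dist (S y) (W y))). Qed.

Lemma L1_dist_ae S S' U : aut_eq S S' -> L1_dist Phi S U = L1_dist Phi S' U.
Proof.
by move=> SS'; apply: ae_eq_integral => //; apply: filterS SS' => x ->.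
Qed.

Lemma integral_aut_set S E (f : T -> \bar R) : measurable E ->
  measurable_fun setT f -> (forall x, 0 <= f x)%E ->
  (\int[mu]_(x in E) f (S x) = \int[mu]_(y in S @` E) f y)%E.
Proof.
move=> mE mf f0; rewrite integral_mkcond [RHS]integral_mkcond.
rewrite -[RHS](integral_aut S).
- apply: eq_integral => x _; rewrite !patchE; congr (if _ then _ else _).
  apply/idP/idP; rewrite !inE; first by exists x.
  by move=> [y Ey /aut_inj <-].
- apply/(measurable_restrictT _ _).1 => //; first exact: measurable_aut_image.
  exact: measurable_funTS.
- by move=> x; rewrite patchE; case: ifP.
Qed.

(** Absolute continuity of the integral, for a function that may be infinite on
    a null set. *)
Lemma integral_small_set (f : T -> \bar R) (e : R) : measurable_fun setT f ->
  (forall x, 0 <= f x)%E -> (\int[mu]_x f x < +oo)%E -> 0 < e ->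
  exists2 r : R, 0 < r & forall E, measurable E -> (mu E < r%:E)%E ->
    (\int[mu]_(x in E) f x < e%:E)%E.
Proof.
move=> mf f0 f_fin e0.
have intf : mu.-integrable setT f.
  apply/integrableP; split=> //.
  by under eq_integral do rewrite gee0_abs//.
have aef : {ae mu, forall x, f x = (fine (f x))%:E}.
  have := integrable_ae measurableT intf.
  by apply: filterS => x /(_ I) fx; rewrite fineK.
have intff : mu.-integrable setT (EFin \o (fine \o f)).
  apply/integrableP; split.
    by apply/measurable_EFinP; exact: measurableT_comp.
  move: f_fin; congr (_ < _)%E; apply: ae_eq_integral => //.
    apply: measurableT_comp => //; apply/measurable_EFinP; exact: measurableT_comp.
  apply: filterS aef => x fx _ /=.
  by rewrite ger0_norm ?fine_ge0.
have [r [r0 rP]] := integral_normr_continuous intff e0.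
exists r => // E mE Er; have := rP E mE Er.
rewrite (_ : (\int[mu]_(x in E) f x)%E =
   (\int[mu]_(x in E) `|(fine \o f) x|)%R%:E).
  by rewrite lte_fin.
rewrite /Rintegral fineK.
  apply: ae_eq_integral => //; first exact: measurable_funTS.
    apply/measurable_EFinP; apply: measurableT_comp => //; exact/measurable_funTS/measurableT_comp.
  apply: filterS aef => x fx _ /=.
  by rewrite ger0_norm ?fine_ge0.
apply: integrable_fin_num => //; apply: (@integrableS _ _ _ _ setT) => //.
by have := integrable_norm intff.
Qed.

Lemma measurable_aut_neq S U : measurable [set x | S x <> U x].
Proof.
rewrite (_ : [set _ | _] = setT `&` [set x | 1 <= dist (S x) (U x)]%E).
  exact: emeasurable_fun_c_infty.
rewrite setTI; apply/seteqP; split => x /=; first exact: dist_ge1.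
by move=> + SU; rewrite SU dist_refl lee_fin ler10.
Qed.

(** Two distinct points are at distance at least one. *)
Lemma measure_aut_neq S U : (mu [set x | S x <> U x] <= L1_dist Phi S U)%E.
Proof.
have mE := measurable_aut_neq S U.
rewrite -[leLHS]mul1e -[leLHS](integral_cst mu mE 1%E).
apply: le_trans (ge0_subset_integral _ mE measurableT _ _ _) => //.
apply: ge0_le_integral => //; first exact: measurable_funTS.
by move=> x /= SU; exact: dist_ge1.
Qed.

(** Right multiplications are isometries, but left multiplications are not, as
    [S] need not preserve the distance on the classes.  Since [U] and [W] differ
    on a set of small measure, the integrals of the displacement of [S] over the
    images of that set under [U] and [W] are small. *)
Lemma L1_comp_continuous S W (e : R) : L1_full_group Phi S -> 0 < e ->
  exists2 r : R, 0 < r & forall U, (L1_dist Phi U W < r%:E)%E ->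
    (L1_dist Phi (aut_comp S U) (aut_comp S W) < e%:E)%E.
Proof.
move=> /L1_full_groupP S1 e0; have e30 : 0 < e / 3 by lra.
have [r r0 rP] := integral_small_set (mdist1 S) (fun=> dist_ge0 _ _ _) S1 e30.
exists (Num.min r (e / 3)) => [|U]; first by rewrite lt_min r0.
rewrite EFin_min lt_min => /andP[UWr UWe].
pose E := [set x | U x <> W x]; have mE : measurable E by exact: measurable_aut_neq.
have small V : (\int[mu]_(x in E) dist (V x) (S (V x)) < (e / 3)%:E)%E.
  rewrite (@integral_aut_set _ _ (fun y => dist y (S y)))//.
  apply: rP; first exact: measurable_aut_image.
  by rewrite measure_aut_image//; exact: le_lt_trans (measure_aut_neq U W) _.
have mSV V : measurable_fun setT (fun x => dist (V x) (S (V x))).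
  exact: (mdistA V (aut_comp S V)).
have mSVE V : measurable_fun setT ((fun x => dist (V x) (S (V x))) \_ E).
  apply/(measurable_restrictT _ _).1 => //; exact: measurable_funTS.
have SVE0 V x : (0 <= ((fun x => dist (V x) (S (V x))) \_ E) x)%E.
  by rewrite patchE; case: ifP.
apply: (@le_lt_trans _ _ (\int[mu]_x
    (((fun x => dist (U x) (S (U x))) \_ E) x +
     ((fun x => dist (W x) (S (W x))) \_ E) x + dist (U x) (W x)))%E).
  apply: ge0_le_integral => //.
    by do 2?apply: emeasurable_funD.
  move=> x _ /=; have [UW|UW] := pselect (U x = W x).
    by rewrite UW dist_refl !adde_ge0.
  rewrite !patchE mem_set//.
  apply: (le_trans (dist_triangle Phi (U x) _ _)).
  rewrite -addeA; apply: leeD; first by rewrite dist_sym.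
  by rewrite addeC; exact: dist_triangle.
rewrite ge0_integralD//; last 2 first.
- by move=> x _; rewrite !adde_ge0.
- exact: emeasurable_funD.
rewrite ge0_integralD// -!integral_mkcond.
rewrite (_ : e = e / 3 + e / 3 + e / 3); last by lra.
by rewrite !EFinD !lteD.
Qed.

Lemma L1_closure_sub A : A `<=` L1_full_group Phi -> A `<=` L1_closure Phi A.
Proof.
move=> AL S AS; split; first exact: AL.
by move=> e e0; exists S => //; rewrite L1_dist_refl lte_fin.
Qed.

Lemma L1_closureS A A' : A `<=` A' -> L1_closure Phi A `<=` L1_closure Phi A'.
Proof.
move=> AA' S [LS SA]; split=> // e /SA[U AU SU]; by exists U => //; exact: AA'.
Qed.

Lemma L1_closure_idem A : L1_closure Phi (L1_closure Phi A) `<=` L1_closure Phi A.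
Proof.
move=> S [LS SA]; split=> // e e0; have e20 : 0 < e / 2 by lra.
have [U [_ /(_ _ e20)[W AW UW]] SU] := SA _ e20; exists W => //.
apply: le_lt_trans (L1_dist_triangle U _ _) _.
by rewrite [e]splitr EFinD lteD.
Qed.

Lemma L1_closure_subgroup A : A `<=` L1_full_group Phi -> aut_subgroup A ->
  aut_subgroup (L1_closure Phi A).
Proof.
move=> AL [A1 AM AV AE]; split.
- exact: L1_closure_sub.
- move=> S U [LS SA] [LU UA]; split; first exact: L1_comp.
  move=> e e0; have e20 : 0 < e / 2 by lra.
  have [S' AS' SS'] := SA _ e20.
  have [r r0 rP] := L1_comp_continuous U (AL _ AS') e20.
  have [U' AU' UU'] := UA _ r0.
  exists (aut_comp S' U'); first exact: AM.
  apply: le_lt_trans (L1_dist_triangle (aut_comp S' U) _ _) _.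
  rewrite L1_dist_compr [e]splitr EFinD lteD//.
  by rewrite L1_dist_sym rP// L1_dist_sym.
- move=> S [LS SA]; split; first exact: L1_inv.
  move=> e e0; have [r r0 rP] := L1_comp_continuous S (L1_inv LS) e0.
  have [U AU SU] := SA _ r0.
  exists (aut_inv U); first exact: AV.
  rewrite L1_dist_sym in SU.
  have -> : L1_dist Phi (aut_inv S) (aut_inv U) = L1_dist Phi
      (aut_comp (aut_comp (aut_inv S) U) (aut_inv U))
      (aut_comp (aut_comp (aut_inv S) S) (aut_inv U)).
    by apply: eq_integral => x _ /=; rewrite aut_funK aut_ifunK.
  by rewrite L1_dist_compr; exact: rP.
- move=> S U SU [LS SA]; split; first exact: L1_ae SU LS.
  move=> e /SA[W AW SW]; exists W => //.
  by rewrite -(L1_dist_ae _ SU).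
Qed.
End L1.

(** * Restrictions, swaps and invariant sets *)

Lemma measureD_eq0 (R : realType) d (T : measurableType d)
    (m : {measure set T -> \bar R}) (A B : set T) :
  measurable A -> measurable B -> m A \is a fin_num ->
  m A = m B -> m (B `\` A) = 0%E -> m (A `\` B) = 0%E.
Proof.
move=> mA mB Afin AB BA0; rewrite measureD//; last by rewrite ltey_eq Afin.
rewrite -[RHS](subee Afin); congr (_ - _)%E; apply/esym.
rewrite AB setIC; apply: etrans (measureDI m mB mA) _.
by rewrite -[RHS]add0e; congr (_ + _)%E; exact: BA0.
Qed.

Section constructions.
Context {R : realType} {d : measure_display} {T : measurableType d}.
Context {mu : probability T R}.
Implicit Types (S U V W : aut mu) (C E Y : set T).

(** Exact invariance is needed for the restriction to be a bijection;
    [ae_invariant] provides it from invariance almost everywhere. *)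
Lemma aut_restrict S E : measurable E -> (forall x, E (S x) <-> E x) ->
  exists2 W : aut mu, forall x, E x -> W x = S x & forall x, ~ E x -> W x = x.
Proof.
move=> mE ES.
pose f x := if x \in E then S x else x.
pose g x := if x \in E then aut_inv S x else x.
have SE x : (S x \in E) = (x \in E) by apply/idP/idP; rewrite !inE => /ES.
have VE x : (aut_inv S x \in E) = (x \in E).
  by rewrite -[in RHS](aut_ifunK S x) SE.
have fK : cancel f g.
  move=> x; rewrite /f /g; have [xE|xE] := boolP (x \in E).
    by rewrite SE xE; exact: aut_funK.
  by rewrite !(negbTE xE).
have gK : cancel g f.
  move=> x; rewrite /f /g; have [xE|xE] := boolP (x \in E).
    by rewrite VE xE; exact: aut_ifunK.
  by rewrite !(negbTE xE).
have mEb : measurable_fun setT (fun x => x \in E).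
  apply: (@measurable_fun_bool _ _ _ _ true); rewrite setTI.
  by rewrite (_ : _ @^-1` _ = E)//; apply/seteqP; split=> x /=; [exact: set_mem|exact: mem_set].
have mf : measurable_fun setT f.
  by apply: measurable_fun_ifT => //; exact: measurable_aut_fun.
have mg : measurable_fun setT g.
  by apply: measurable_fun_ifT => //; exact: measurable_aut_fun.
have fpres A : measurable A -> mu (f @^-1` A) = mu A.
  move=> mA; have -> : f @^-1` A = S @^-1` (A `&` E) `|` A `\` E.
    apply/seteqP; split => x; rewrite /f /=; have [Ex|nEx] := pselect (E x).
    - by rewrite mem_set// => ?; left; split=> //; apply/ES.
    - by rewrite memNset// => ?; right.
    - by rewrite mem_set// => -[[]|[]].
    - by rewrite memNset// => -[[_ /ES]|[]].
  rewrite measureU.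
  - rewrite (measureDI mu mA mE) addeC; congr (_ + _)%E.
    by apply: aut_preserving; exact: measurableI.
  - by apply: measurable_aut_preimage; exact: measurableI.
  - exact: measurableD.
  - by apply/seteqP; split=> // x [[_ /ES Ex] []].
exists (Aut fK gK mf mg fpres) => x Ex /=; first by rewrite /f mem_set.
by rewrite /f memNset.
Qed.

(** [V] is an involution determined by [S] and [C] when [C] is disjoint from its
    image under [S]; for an involution [S], it is the restriction of [S] to
    the union of [C] and its image. *)
Definition swaps V S C := (forall x, C x -> V x = S x /\ V (S x) = x) /\
  (forall x, ~ C x -> ~ (S @` C) x -> V x = x).

Lemma swaps_invol V S C : swaps V S C -> forall x, V (V x) = x.
Proof.
move=> [VC Vo] x; have [/VC[-> ->//]|nCx] := pselect (C x).
have [[y /VC[yS Sy] <-]|nSx] := pselect ((S @` C) x); first by rewrite Sy yS.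
by rewrite !(Vo x).
Qed.

Lemma swap_exists S C : measurable C -> (forall x, C x -> ~ C (S x)) ->
  exists V, swaps V S C.
Proof.
move=> mC CS; have [|V [VK Vd VE]] := @swap_partial_iso _ _ _ _ (pi_of_aut S mC).
  by move=> _ /[swap] -[y Cy <-]; exact: CS.
exists V; split=> [x Cx|x nCx nSx].
  by have VS := Vd x Cx; rewrite VS; split=> //; rewrite -{2}(VK x) VS.
have [//|[[//]|[CV xE]]] := VE x.
by case: nSx; exists (V x).
Qed.

(** The points whose whole orbit avoids a null set containing the points where
    [P] fails. *)
Lemma ae_invariant S (P : T -> Prop) : {ae mu, forall x, P x} ->
  exists E, [/\ measurable E, forall x, E (S x) <-> E x, E `<=` P &
    {ae mu, forall x, E x}].
Proof.
move=> [N [mN N0 PN]]; set S' := aut_inv S.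
pose G n := ~` (iter n S @^-1` N) `&` ~` (iter n S' @^-1` N).
have mG n : measurable (G n).
  by apply: measurableI; apply/measurableC/measurable_preimage => //;
    exact: measurable_iter.
have shift n x : iter n.+1 S' (S x) = iter n S' x.
  by rewrite iterSr /= aut_funK.
exists (\bigcap_n G n); split.
- exact: bigcapT_measurable.
- move=> x; split=> Gx n _; split; rewrite /preimage /=.
  + case: n => [|n]; last by rewrite iterSr; case: (Gx n I).
    by case: (Gx 1%N I) => _; rewrite /preimage /= aut_funK.
  + by rewrite -shift; case: (Gx n.+1 I).
  + by rewrite -iterSr; case: (Gx n.+1 I).
  + case: n => [|n]; last by rewrite shift; case: (Gx n I).
    by case: (Gx 1%N I).
- by move=> x /(_ 0%N I)[/= nNx _]; apply: contrapT => nPx; apply: nNx; exact: PN.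
- exists (\bigcup_n (aut_iter S n @^-1` N `|` aut_iter S' n @^-1` N)); split.
  + by apply: bigcupT_measurable => n; apply: measurableU;
      exact: measurable_aut_preimage.
  + apply/negligibleP.
      by apply: bigcupT_measurable => n; apply: measurableU;
        exact: measurable_aut_preimage.
    apply: negligible_bigcup => n; apply: negligibleU; (apply/negligibleP;
      [exact: measurable_aut_preimage|exact: etrans (aut_preserving _ mN) N0]).
  + move=> x; apply: contra_notP => nx n _; split=> Nx; apply: nx; exists n => //;
    by [left; rewrite /preimage /= aut_iterE|right; rewrite /preimage /= aut_iterE].
Qed.

(** The form of Poincare recurrence used below: here [E] will be the set of
    points whose forward orbit meets a given set. *)
Lemma preimage_sub_null S E : measurable E -> S @^-1` E `<=` E ->
  mu (E `\` S @^-1` E) = 0%E.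
Proof.
move=> mE SE; apply: measureD_eq0 => //.
- exact: measurable_aut_preimage.
- exact: fin_num_measure.
- exact/esym/aut_preserving.
- by rewrite (_ : _ `\` _ = set0) ?measure0//; apply/seteqP; split=> // x [/SE].
Qed.

End constructions.

(** * Splitting an element along a set *)

Section splitting.
Context {R : realType} {d : measure_display} {T : measurableType d}.
Context {mu : probability T R}.
Variable Phi : set (partial_iso mu).
Implicit Types (S U V W : aut mu) (C E Y : set T).
Local Notation dist := (graphing_dist Phi).
Local Notation L1 := (L1_full_group Phi).
Hypothesis mdist : forall f g : T -> T, measurable_fun setT f ->
  measurable_fun setT g -> measurable_fun setT (fun x => dist (f x) (g x)).
Hint Resolve dist_ge0 measurable_aut_fun : core.

Let mdisp S : measurable_fun setT (fun x => dist x (S x)).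
Proof. by apply: mdist => //; exact: measurable_id. Qed.

(** Restrictions and swaps of [S] move each point along one step of its
    [S]-orbit at most. *)
Lemma L1_steps S W : L1 S ->
  (forall x, W x = x \/ W x = S x \/ W x = aut_inv S x) -> L1 W.
Proof.
move=> S1 WS; have /(L1_full_groupP mdist) S1' := S1.
have /(L1_full_groupP mdist) V1' := L1_inv mdist S1.
apply: (@L1_full_group_dominated _ _ _ _ _ mdist _
  (fun x => dist x (S x) + dist x (aut_inv S x))%E).
- exact: emeasurable_funD.
- rewrite ge0_integralD//. by apply: lte_add_pinfty.
- apply: aeW => x; case: (WS x) => [->|[->|->]].
  + by rewrite dist_refl adde_ge0.
  + by apply: leeDl; exact: dist_ge0.
  + by apply: leeDr; exact: dist_ge0.
Qed.

Lemma L1_swaps S V C : L1 S -> swaps V S C -> L1 V.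
Proof.
move=> S1 [VC Vo]; apply: (L1_steps S1) => x.
have [/VC[-> _]|nC] := pselect (C x); first by right; left.
have [[y /VC[_ Vy] <-]|nSC] := pselect ((S @` C) x); last by left; exact: Vo.
by right; right; rewrite Vy; apply/esym/aut_funK.
Qed.

Lemma involution_swaps S V C : L1 S -> swaps V S C -> L1_involutions Phi V.
Proof.
by move=> S1 VS; split; [exact: L1_swaps VS|apply: aut_eqW; exact: swaps_invol VS].
Qed.

Section first_exit.
Variables (S : aut mu) (Y : set T).
Hypothesis mY : measurable Y.

(** First points of the excursions out of [Y] lasting more than [n] steps.
    The translates [iter n S @` away n] are pairwise disjoint, and this is what
    bounds the displacement of the swap. *)
Let away n : set T :=
  [set x | Y (aut_inv S x) /\ forall i, (i <= n)%N -> ~ Y (iter i S x)].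

Let mS i : measurable (iter i S @^-1` Y).
Proof. by apply: measurable_preimage => //; exact: measurable_iter. Qed.

Let maway n : measurable (away n).
Proof.
rewrite (_ : away n = aut_inv S @^-1` Y `&`
    \bigcap_(i in [set i | (i <= n)%N]) ~` (iter i S @^-1` Y)).
  apply: measurableI; first exact: measurable_aut_preimage.
  by apply: bigcap_measurable => [|i _]; [exists 0%N|exact: measurableC].
by apply/seteqP; split.
Qed.

Let away_disj i j x y : away i x -> away j y -> iter i S x = iter j S y -> i = j.
Proof.
wlog ij : i j x y / (i < j)%N => [h Ax Ay xy|].
  case: (ltngtP i j) => // ij; first exact: h ij Ax Ay xy.
  by apply/esym; exact: h ij Ay Ax (esym xy).
move=> [Yx _] [_ nYy]; rewrite -(subnKC (ltnW ij)) iterD => /iter_inj xE.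
case: (nYy (j - i).-1); first by lia.
move: Yx; rewrite xE -[in aut_inv _ _](@prednK (j - i)) ?subn_gt0//.
by rewrite iterS /= aut_funK.
Qed.

Let returning n : set T := away n `&` iter n.+1 S @^-1` Y.

Let mreturning n : measurable (returning n).
Proof. exact: measurableI. Qed.

Let phi n : partial_iso mu := pi_of_aut (aut_iter S n.+1) (mreturning n).

Let phi_rng n x : pi_rng (phi n) x ->
  exists2 y, returning n y & x = S (iter n S y).
Proof. by move=> [y ry <-]; exists y => //=; rewrite aut_iterE. Qed.

(** [V] sends the first point of an excursion to the point of return.  Then
    [V \o S] goes from the last point of [Y] before the excursion directly to
    the point of return, and closes the excursion into a cycle. *)
Lemma first_exit_swap : exists2 V : aut mu, (forall x, V (V x) = x) &
  [/\ forall x, S x = x -> V x = x,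
      {ae mu, forall x, Y x -> Y (V (S x))} &
      L1 S -> L1 V].
Proof.
have [i j x|i j x|i j x|V VK [Vd Vr Vo]] := @swap_family _ _ _ _ phi.
- move=> [[_ nYi] Yi] [[_ nYj] Yj]; apply/eqP; rewrite eqn_leq.
  apply/andP; split; rewrite leqNgt; apply/negP => ij.
    exact: nYi Yj.
  exact: nYj Yi.
- move=> /phi_rng[y [Ay _] ->] /phi_rng[z [Az _]] /aut_inj.
  exact: away_disj.
- move=> [[_ nYx] _] /phi_rng[y [_ Yy] xE]; apply: (nYx 0%N) => //=.
  by rewrite xE.
have Vrng x n : pi_rng (phi n) x -> ~ Y (aut_inv S x) /\ Y x.
  move=> /phi_rng[y [[_ nYy] Yy] ->] /=; rewrite aut_funK; split=> //.
  exact: nYy.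
exists V => //; split.
- move=> x xS; apply: Vo => n; have Sx : aut_inv S x = x.
    by rewrite -{1}xS; exact: aut_funK.
  split.
    by move=> [[Yx nYx] _]; apply: (nYx 0%N) => //; rewrite Sx in Yx.
  by move=> /Vrng[]; rewrite Sx.
- pose J := \bigcup_n (iter n S @^-1` Y).
  have mJ : measurable J by exact: bigcupT_measurable.
  have SJ : S @^-1` J `<=` J.
    by move=> x [n _ Yn]; exists n.+1 => //; rewrite /preimage /= -iterS iterSr.
  exists (J `\` S @^-1` J); split.
  + by apply: measurableD => //; exact: measurable_aut_preimage.
  + exact: preimage_sub_null.
  move=> x /= /not_implyP[Yx nY]; split; first by exists 0%N.
  move=> [n _ Yn]; apply: nY.
  have [YSx|nYSx] := pselect (Y (S x)).
    rewrite Vo// => k; split.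
      by move=> [[_ nYx] _]; exact: (nYx 0%N).
    by move=> /Vrng[+ _]; rewrite /= aut_funK.
  have ex : exists n, `[< Y (iter n S (S x)) >] by exists n; exact/asboolP.
  have [[|m] /asboolP Ym mmin] := ex_minnP ex; first by [].
  have rm : returning m (S x).
    split; last exact: Ym.
    split; first by rewrite /= aut_funK.
    by move=> i im Yi; have := mmin i (asboolT Yi); rewrite ltnNge im.
  by rewrite (Vd m)//= aut_iterE.
move=> /(L1_full_groupP mdist) S1.
pose g x := dist x (S x).
have mg n : measurable_fun setT (fun x => g (iter n S x)).
  by apply: mdist; [exact: measurable_iter|exact: (measurable_iter S n.+1)].
(* the sum of the t n at x bounds the distance from x to the point of return *)
pose t n := (fun x => g (iter n S x)) \_ (away n).
have mt n : measurable_fun setT (t n).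
  by apply/(measurable_restrictT _ _).1 => //; exact: measurable_funTS.
have t0 n x : (0 <= t n x)%E by rewrite /t patchE; case: ifP => _ //; exact: dist_ge0.
pose h x := (\sum_(n <oo) t n x)%E.
have h0 x : (0 <= h x)%E by exact: nneseries_ge0.
have mh : measurable_fun setT h by exact: ge0_emeasurable_sum.
have h_fin : (\int[mu]_x h x < +oo)%E.
  rewrite /h integral_nneseries//.
  apply: le_lt_trans S1.
  have -> : (\sum_(n <oo) \int[mu]_x t n x =
      \int[mu]_(x in \bigcup_n (aut_iter S n @` away n)) g x)%E.
    rewrite ge0_integral_bigcup//.
    - apply: eq_eseriesr => n _; rewrite /t -integral_mkcond.
      rewrite -(@integral_aut_set _ _ _ _ (aut_iter S n));
        [|exact: maway|exact: mdisp|by move=> x; exact: dist_ge0].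
      by apply: eq_integral => x _; rewrite aut_iterE.
    - by move=> n; exact: measurable_aut_image.
    - exact: measurable_funTS (mdisp S).
    - by move=> x _; exact: dist_ge0.
    - apply/trivIsetP => i j _ _ /eqP ij; apply/seteqP; split=> // x.
      move=> [[y Ay <-] [z Az]]; rewrite !aut_iterE => zy; apply: ij.
      exact: away_disj Ay Az (esym zy).
  apply: ge0_subset_integral => //.
  - by apply: bigcupT_measurable => n; exact: measurable_aut_image.
  - exact: mdisp.
  - by move=> x _; exact: dist_ge0.
have dist_iter n x : (dist x (iter n S x) <= \sum_(i < n) g (iter i S x))%E.
  elim: n => [|n IHn]; first by rewrite big_ord0 dist_refl.
  rewrite big_ord_recr /=; apply: (le_trans (dist_triangle _ (iter n S x) _ _)).
  by rewrite leeD.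
have hd n x : pi_dom (phi n) x -> (dist x (V x) <= h x)%E.
  move=> Dx; rewrite (Vd _ _ Dx) /= -/(aut_iter S n.+1) aut_iterE.
  apply: (le_trans (dist_iter n.+1 x)).
  apply: (le_trans _ (nneseries_lim_ge n.+1 (fun i _ _ => t0 i x))).
  rewrite big_mkord; apply: lee_sum => i _.
  rewrite /t patchE mem_set//; case: Dx => -[Yx nYx] _; split=> // k ki.
  by apply: nYx; apply: leq_trans ki _; rewrite -ltnS.
apply: (@L1_full_group_dominated _ _ _ _ _ mdist _ (fun x => h x + h (V x))%E).
- apply: emeasurable_funD => //; exact: measurableT_comp.
- rewrite ge0_integralD//; last exact: measurableT_comp.
  by rewrite integral_aut//; exact: lte_add_pinfty.
apply: aeW => x.
have [[n Dx]|nD] := pselect (exists n, pi_dom (phi n) x).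
  by apply: (le_trans (hd _ _ Dx)); apply: leeDl; exact: h0.
have [[n]|nR] := pselect (exists n, pi_rng (phi n) x).
  rewrite pi_rngE => -[y Dy <-]; rewrite (Vr _ _ Dy).
  rewrite -[in leLHS](Vd _ _ Dy) dist_sym; apply: (le_trans (hd _ _ Dy)).
  by apply: leeDr; exact: h0.
rewrite Vo ?dist_refl ?adde_ge0// => n; split=> ?; [apply: nD|apply: nR]; by exists n.
Qed.
End first_exit.

(** An automorphism that maps [Y] into itself also maps the complement of [Y]
    into itself, up to null sets, since it preserves a finite measure. *)
Lemma invariant_split W Y : measurable Y -> {ae mu, forall x, Y x -> Y (W x)} ->
  exists W1 W2, [/\ aut_eq W (aut_comp W1 W2),
    forall x, W1 x = x \/ (Y x /\ W1 x = W x) &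
    forall x, W2 x = x \/ (~ Y x /\ W2 x = W x)].
Proof.
move=> mY [N [mN N0 YN]].
have N'0 : mu (Y `\` W @^-1` Y) = 0%E.
  apply: (@subset_measure0 _ _ _ _ _ N) => //.
    by apply: measurableD => //; exact: measurable_aut_preimage.
  by move=> x [Yx nYx]; apply: YN => /(_ Yx).
have N''0 : mu (W @^-1` Y `\` Y) = 0%E.
  have mWY := measurable_aut_preimage W mY.
  apply: measureD_eq0 => //; first exact: fin_num_measure.
  exact: aut_preserving.
have ae : {ae mu, forall x, Y x <-> Y (W x)}.
  exists ((Y `\` W @^-1` Y) `|` (W @^-1` Y `\` Y)); split.
  - by apply: measurableU; apply: measurableD => //; exact: measurable_aut_preimage.
  - rewrite measureU0//; first by apply: measurableD => //; exact: measurable_aut_preimage.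
    by apply: measurableD => //; exact: measurable_aut_preimage.
  - move=> x /= nYW; have [Yx|nYx] := pselect (Y x); [left|right].
      by split=> // YWx; apply: nYW.
    by split=> //; apply: contrapT => nYWx; apply: nYW.
have [E [mE EW EP Eae]] := ae_invariant W ae.
have [W1 W1E W1o] : exists2 W1 : aut mu, forall x, (E `&` Y) x -> W1 x = W x &
    forall x, ~ (E `&` Y) x -> W1 x = x.
  apply: aut_restrict => [|x]; first exact: measurableI.
  split=> -[Ex Yx].
    by have Ex' := (EW x).1 Ex; split=> //; exact: (EP x Ex').2.
  by split; [exact: (EW x).2|exact: (EP x Ex).1].
have [W2 W2E W2o] : exists2 W2 : aut mu, forall x, (E `\` Y) x -> W2 x = W x &
    forall x, ~ (E `\` Y) x -> W2 x = x.
  apply: aut_restrict => [|x]; first exact: measurableD.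
  split=> -[Ex nYx].
    by have Ex' := (EW x).1 Ex; split=> //; move=> Yx; apply/nYx/(EP x Ex').1.
  by split; [exact: (EW x).2|move=> YWx; apply/nYx/(EP x Ex).2].
exists W1, W2; split.
- apply: filterS Eae => x Ex /=.
  have [Yx|nYx] := pselect (Y x).
    by rewrite W2o; [rewrite W1E|case].
  rewrite W2E// W1o// => -[_ YWx]; apply: nYx; exact/(EP _ Ex).
- move=> x; have [Ex|nEx] := pselect ((E `&` Y) x).
    by right; split; [case: Ex|exact: W1E].
  by left; exact: W1o.
- move=> x; have [Ex|nEx] := pselect ((E `\` Y) x).
    by right; split; [case: Ex|exact: W2E].
  by left; exact: W2o.
Qed.

(** The last condition lets supports decrease when the splitting is iterated
    along several sets. *)
Lemma L1_split S Y : measurable Y -> L1 S ->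
  exists V S1 S2, [/\ L1_involutions Phi V,
    aut_eq S (aut_comp V (aut_comp S1 S2)),
    L1 S1 /\ (forall x, ~ Y x -> S1 x = x),
    L1 S2 /\ (forall x, Y x -> S2 x = x) &
    forall x, S x = x -> S2 x = x].
Proof.
move=> mY S1; have [V VK [VS YV LV]] := first_exit_swap S mY.
have {}LV := LV S1; have LW := L1_comp mdist LV S1.
have [W1 [W2 [WE W1o W2o]]] := @invariant_split (aut_comp V S) Y mY YV.
exists V, W1, W2; split.
- by split=> //; exact: aut_eqW.
- by apply: filterS WE => x /= <-; rewrite VK.
- split; first by apply: (L1_steps LW) => x; case: (W1o x) => [|[]]; auto.
  by move=> x nYx; case: (W1o x) => [//|[]].
- split; first by apply: (L1_steps LW) => x; case: (W2o x) => [|[]]; auto.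
  by move=> x Yx; case: (W2o x) => [//|[]].
- by move=> x xS; case: (W2o x) => [//|[_ ->]] /=; rewrite xS VS.
Qed.

End splitting.

(** * Commutators are products of involutions *)

Section ae_group.
Context {R : realType} {d : measure_display} {T : measurableType d}.
Context {mu : probability T R}.
Implicit Types (S U V W : aut mu).

Definition aut_conj S U : aut mu := aut_comp (aut_comp S U) (aut_inv S).

Lemma aut_eq_compr S S' U : aut_eq S S' -> aut_eq (aut_comp S U) (aut_comp S' U).
Proof. exact: ae_aut. Qed.

Lemma aut_eq_compl S U U' : aut_eq U U' -> aut_eq (aut_comp S U) (aut_comp S U').
Proof. by apply: filterS => x /= ->. Qed.

Lemma aut_eq_trans S U V : aut_eq S U -> aut_eq U V -> aut_eq S V.
Proof. by apply: filterS2 => x -> ->. Qed.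

Lemma aut_eq_inv S S' : aut_eq S S' -> aut_eq (aut_inv S) (aut_inv S').
Proof.
move=> /(ae_aut (aut_inv S)); apply: filterS => x /=.
by rewrite aut_ifunK => xE; rewrite {2}xE aut_funK.
Qed.

Lemma aut_eq_comm S U U' : aut_eq U U' -> aut_eq (aut_comm S U) (aut_comm S U').
Proof.
move=> UU'; apply: (@aut_eq_trans _ (aut_comp (aut_comp S U')
    (aut_comp (aut_inv S) (aut_inv U)))).
  exact/aut_eq_compr/aut_eq_compl.
exact/aut_eq_compl/aut_eq_compl/aut_eq_inv.
Qed.

Lemma aut_eq_conj S U U' : aut_eq U U' -> aut_eq (aut_conj S U) (aut_conj S U').
Proof. by move=> UU'; exact/aut_eq_compr/aut_eq_compl. Qed.

(** The sets [B k] minus their inverse images are disjoint from their images and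
    cover the support of [S]; they are added one after the other, each deprived
    of the neighbours of the points already chosen. *)
Lemma maximal_independent (B : nat -> set T) S :
  (forall k, measurable (B k)) ->
  (forall x y, x <> y -> exists k, B k x /\ ~ B k y) ->
  exists Y, [/\ measurable Y, forall x, Y x -> ~ Y (S x) &
    forall x, S x <> x -> [\/ Y x, Y (S x) | Y (aut_inv S x)]].
Proof.
move=> mB sepB.
pose Y k := B k `\` S @^-1` B k.
pose nb (Z : set T) := S @^-1` Z `|` aut_inv S @^-1` Z.
pose Z := fix Z k := if k is j.+1 then Z j `|` (Y j `\` nb (Z j)) else set0.
have mZ k : measurable (Z k).
  elim: k => [|k IHk] /=; first exact: measurable0.
  apply: measurableU => //; apply: measurableD.
    by apply: measurableD => //; exact: measurable_aut_preimage.
  by apply: measurableU; exact: measurable_aut_preimage.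
have ZS j k : (j <= k)%N -> Z j `<=` Z k.
  move=> /subnK <-; elim: (k - j)%N => [//|m IHm]; rewrite addSn.
  by apply: (subset_trans IHm) => x; left.
have Zind k x : Z k x -> ~ Z k (S x).
  elim: k x => [//|k IHk] x /= [Zx|[[Bx nBx] nZx]] [ZSx|[[BSx nBSx] nZSx]].
  - exact: IHk Zx ZSx.
  - by apply: nZSx; right; rewrite /preimage /= aut_funK.
  - by apply: nZx; left.
  - exact: nBx.
exists (\bigcup_k Z k); split.
- exact: bigcupT_measurable.
- move=> x [j _ Zj] [k _ Zk]; apply: (@Zind (maxn j k) x).
    exact: ZS (leq_maxl _ _) _ Zj.
  exact: ZS (leq_maxr _ _) _ Zk.
move=> x xS; have [k [Bx nBSx]] := sepB _ _ (not_eq_sym xS).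
have [[ZSx|ZVx]|nZ] := pselect (nb (Z k) x).
- by constructor 2; exists k.
- by constructor 3; exists k.
by constructor 1; exists k.+1 => //; right.
Qed.
End ae_group.

Section derived_in_involutions.
Context {R : realType} {d : measure_display} {T : measurableType d}.
Context {mu : probability T R}.
Variable Phi : set (partial_iso mu).
Implicit Types (S U V W : aut mu) (C E Y : set T).
Local Notation dist := (graphing_dist Phi).
Local Notation L1 := (L1_full_group Phi).
Local Notation N := (aut_generated (L1_involutions Phi)).
Hypothesis mdist : forall f g : T -> T, measurable_fun setT f ->
  measurable_fun setT g -> measurable_fun setT (fun x => dist (f x) (g x)).

Let Nsub : aut_subgroup N. Proof. exact: aut_generated_subgroup. Qed.
Let NM S U : N S -> N U -> N (aut_comp S U). Proof. by case: Nsub => _ + _ _; apply. Qed.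
Let NV S : N S -> N (aut_inv S). Proof. by case: Nsub => _ _ + _; apply. Qed.
Let NE S U : aut_eq S U -> N S -> N U. Proof. by case: Nsub => _ _ _; apply. Qed.
Let Ninv V : L1_involutions Phi V -> N V. Proof. exact: aut_generated_sub. Qed.

Lemma involution_conj S V :
  L1 S -> L1_involutions Phi V -> L1_involutions Phi (aut_conj S V).
Proof.
move=> S1 [V1 VV]; split.
  by apply: L1_comp => //; [exact: L1_comp|exact: L1_inv].
apply: aut_eq_trans (aut_eqW _) (aut_eq_trans (aut_eq_conj S VV) (aut_eqW _)).
  by move=> x /=; rewrite aut_funK.
by move=> x /=; rewrite aut_ifunK.
Qed.

Lemma involutions_normal S U : L1 S -> N U -> N (aut_conj S U).
Proof.
move=> S1; pose G := [set U | N (aut_conj S U)].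
suff : N `<=` G by apply.
apply: aut_generated_min; last first.
  by move=> V V2; exact: (Ninv (involution_conj S1 V2)).
rewrite /G; split=> /=.
- case: Nsub => N1 _ _ _; apply: (NE _ N1).
  by apply: aut_eqW => x /=; rewrite aut_ifunK.
- move=> U1 U2 N1 N2; apply: (NE _ (NM N1 N2)).
  by apply: aut_eqW => x /=; rewrite aut_funK.
- by move=> W NW; apply: (NE _ (NV NW)); exact: aut_eqW.
- by move=> W W' WW'; exact: (NE (aut_eq_conj S WW')).
Qed.

(** The commutator is the product of a conjugate of [V] and of [V^-1]. *)
Lemma comm_involution S V : L1 S -> L1_involutions Phi V -> N (aut_comm S V).
Proof.
move=> S1 V2; apply: (@NE (aut_comp (aut_conj S V) (aut_inv V))).
  exact: aut_eqW.
exact: (NM (Ninv (involution_conj S1 V2)) (NV (Ninv V2))).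
Qed.

(** This is the identity [S, UW] = [S, U] (U [S, W] U^-1) together with the
    normality of the subgroup generated by involutions. *)
Lemma comm_comp S U W :
  L1 U -> N (aut_comm S U) -> N (aut_comm S W) -> N (aut_comm S (aut_comp U W)).
Proof.
move=> U1 NU NW.
apply: (@NE (aut_comp (aut_comm S U) (aut_conj U (aut_comm S W)))).
  by apply: aut_eqW => x /=; rewrite !aut_funK.
exact: (NM NU (involutions_normal U1 NW)).
Qed.

(** The involution [V] exchanging [C] and its image under [S] conjugates [U]
    like [S] does, so that the commutator of [S] and [U] is that of [V] and [U]. *)
Lemma comm_displaced S U C : measurable C -> L1 S -> L1 U ->
  (forall x, C x -> ~ C (S x)) -> (forall x, ~ C x -> U x = x) ->
  N (aut_comm S U).
Proof.
move=> mC S1 U1 CS Uo; have [V VS] := swap_exists mC CS.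
have V2 : L1_involutions Phi V by exact: (involution_swaps mdist S1 VS).
have [VC Vo] := VS; have VK := swaps_invol VS.
have UC x : C x -> C (U x).
  move=> Cx; apply: contrapT => nCUx; have := Uo _ nCUx => /aut_inj UUx.
  by apply: nCUx; rewrite UUx.
have conjE x : S (U (aut_inv S x)) = V (U (V x)).
  have [[y Cy <-]|nSC] := pselect ((S @` C) x).
    by rewrite /= aut_funK (VC _ Cy).2 (VC _ (UC _ Cy)).1.
  rewrite Uo; last by move=> CSx; apply: nSC; exists (aut_inv S x) => //; exact: aut_ifunK.
  rewrite [LHS]aut_ifunK; have [Cx|nC] := pselect (C x).
    by rewrite (VC _ Cx).1 Uo ?(VC _ Cx).2//; exact: CS.
  by rewrite Vo// Uo// Vo.
apply: (@NE (aut_comp V (aut_conj U V))).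
  apply: aut_eqW => x /=; rewrite conjE /=; congr (V (U _)).
exact: (NM (Ninv V2) (Ninv (involution_conj U1 V2))).
Qed.

Variable B : nat -> set T.
Hypothesis mB : forall k, measurable (B k).
Hypothesis sepB : forall x y, x <> y -> exists k, B k x /\ ~ B k y.

(** [U] is split along [Y], maximal among the sets disjoint from their image,
    and along its two translates.  Each of them is disjoint from its own image,
    and what remains commutes with [S]. *)
Lemma L1_comm S U : L1 S -> L1 U -> N (aut_comm S U).
Proof.
move=> S1 U1; have [Y [mY Yind Ycov]] := maximal_independent S mB sepB.
pose Y2 := S @^-1` Y; pose Y3 := aut_inv S @^-1` Y.
have mY2 : measurable Y2 by exact: measurable_aut_preimage.
have mY3 : measurable Y3 by exact: measurable_aut_preimage.
have Y2ind x : Y2 x -> ~ Y2 (S x) by exact: Yind.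
have Y3ind x : Y3 x -> ~ Y3 (S x).
  by move=> Yx; rewrite /Y3 /preimage /= aut_funK => YSx; apply: (Yind _ Yx);
    rewrite /= aut_ifunK.
have [V1 [A1 [U2 [V1i UE [A1L A1o] [U2L U2Y] _]]]] := L1_split mdist mY U1.
have [V2 [A2 [U3 [V2i U2E [A2L A2o] [U3L U3Y2] U3U2]]]] := L1_split mdist mY2 U2L.
have [V3 [A3 [U4 [V3i U3E [A3L A3o] [U4L U4Y3] U4U3]]]] := L1_split mdist mY3 U3L.
have U4o x : S x <> x -> U4 x = x.
  by case/Ycov => Yx; [exact: U4U3 (U3U2 _ (U2Y _ Yx))|exact: U4U3 (U3Y2 _ Yx)|exact: U4Y3].
have N4 : N (aut_comm S U4).
  case: Nsub => N1 _ _ _; apply: (NE _ N1); apply: aut_eqW => x /=.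
  have commute z : S (U4 z) = U4 (S z).
    have [Sz|Sz] := pselect (S z = z).
      rewrite Sz; apply: contrapT => SU.
      by have := U4o _ SU => /aut_inj Uz; rewrite Uz in SU.
    rewrite U4o// U4o// => SSz; exact: Sz (aut_inj SSz).
  by rewrite commute !aut_ifunK.
have step U0 V A W : L1_involutions Phi V -> aut_eq U0 (aut_comp V (aut_comp A W)) ->
    L1 A -> N (aut_comm S A) -> N (aut_comm S W) -> N (aut_comm S U0).
  move=> Vi U0E LA NA NW; apply: (NE (aut_eq_comm S (aut_eq_sym U0E))).
  apply: comm_comp; [by case: Vi|exact: comm_involution|].
  exact: comm_comp.
apply: (step _ _ _ _ V1i UE) => //; first exact: comm_displaced mY _ _ Yind A1o.
apply: (step _ _ _ _ V2i U2E) => //; first exact: comm_displaced mY2 _ _ Y2ind A2o.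
by apply: (step _ _ _ _ V3i U3E) => //; exact: comm_displaced mY3 _ _ Y3ind A3o.
Qed.

Lemma derived_sub_involutions : aut_derived L1 `<=` N.
Proof.
apply: aut_generated_min => // _ [S [U [S1 U1 ->]]]; exact: L1_comm.
Qed.
End derived_in_involutions.

(** * Involutions are limits of products of commutators *)

Section involutions_in_derived.
Context {R : realType} {d : measure_display} {T : measurableType d}.
Context {mu : probability T R}.
Variable Phi : set (partial_iso mu).
Implicit Types (S U V W : aut mu) (A C E Y : set T).
Local Notation dist := (graphing_dist Phi).
Local Notation L1 := (L1_full_group Phi).
Local Notation D := (aut_derived L1).
Hypothesis mdist : forall f g : T -> T, measurable_fun setT f ->
  measurable_fun setT g -> measurable_fun setT (fun x => dist (f x) (g x)).
Hint Resolve dist_ge0 measurable_aut_fun : core.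

Let mdisp S : measurable_fun setT (fun x => dist x (S x)).
Proof. by apply: mdist => //; exact: measurable_id. Qed.

Lemma derived_L1 : D `<=` L1.
Proof.
have [_ L1M L1V _] := L1_subgroup mdist.
apply: aut_generated_min; first exact: L1_subgroup.
move=> _ [S [U [S1 U1 ->]]]; apply: (L1M _ _ (L1M _ _ S1 U1)).
exact: (L1M _ _ (L1V _ S1) (L1V _ U1)).
Qed.

Lemma aut_inv_invol V : (forall x, V (V x) = x) -> forall x, aut_inv V x = V x.
Proof. by move=> VK x; rewrite -{1}(VK x); exact: aut_funK. Qed.

Lemma eq_swaps V U C C' : (forall x, C x <-> C' x) -> swaps V U C -> swaps V U C'.
Proof. by move=> CC; rewrite (_ : C' = C)//; apply/seteqP; split=> x /CC. Qed.

Section fundamental_domain.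
Variables (U : aut mu) (Y : set T).
Hypothesis Yind : forall x, Y x -> ~ Y (U x).

Lemma swaps_comp W W' A A' : A `<=` Y -> A' `<=` Y -> (forall x, A x -> ~ A' x) ->
  swaps W U A -> swaps W' U A' -> swaps (aut_comp W W') U (A `|` A').
Proof.
move=> AY A'Y AA' [WA Wo] [W'A W'o].
have nU E x : E `<=` Y -> Y x -> ~ (U @` E) x.
  by move=> EY Yx [y /EY Yy yx]; apply: (Yind Yy); rewrite yx.
have nUU E x : ~ E x -> ~ (U @` E) (U x).
  by move=> nE [y Ey /aut_inj yx]; apply: nE; rewrite -yx.
split=> [x [Ax|Ax]|x nx nUx] /=.
- have Yx := AY _ Ax; have nA' := AA' _ Ax; split.
    by rewrite (W'o x nA' (nU _ _ A'Y Yx)) (WA _ Ax).1.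
  have nA'U : ~ A' (U x) by move=> /A'Y; exact: Yind.
  by rewrite (W'o _ nA'U (nUU _ _ nA')) (WA _ Ax).2.
- have Yx := A'Y _ Ax; have nA : ~ A x by move=> /AA'.
  have nAU : ~ A (U x) by move=> /AY; exact: Yind.
  split; first by rewrite (W'A _ Ax).1 (Wo _ nAU (nUU _ _ nA)).
  by rewrite (W'A _ Ax).2 (Wo _ nA (nU _ _ AY Yx)).
have nAx : ~ A x by move=> Ax; apply: nx; left.
have nA'x : ~ A' x by move=> Ax; apply: nx; right.
rewrite W'o//; last by move=> [y Ay yx]; apply: nUx; exists y => //; right.
by rewrite Wo// => -[y Ay yx]; apply: nUx; exists y => //; left.
Qed.

(** With [b] the image of [a] under [G], the permutation
    (a Ua)(b Ub) is the commutator of (a Ua) and (a b)(Ua Ub). *)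
Lemma swaps_commutator (G : aut mu) (k : nat) C : L1 U -> measurable C ->
  (forall x, C x -> [/\ Y x, Y (G x) & ~ C (G x)]) ->
  (forall x, dist x (G x) <= k%:R%:E)%E ->
  exists2 W, D W & swaps W U (C `|` G @` C).
Proof.
move=> U1 mC CG Gk.
have CY x : C x -> Y x by case/CG.
have GY x : C x -> Y (G x) by case/CG.
have nCG x : C x -> ~ C (G x) by case/CG.
have nCU x : C x -> ~ C (U x) by move=> /CY/Yind nY /CY.
have [u uC] := swap_exists mC nCU; have uK := swaps_invol uC.
have u1 := L1_swaps mdist U1 uC; case: uC => uC uo.
have mUC : measurable (U @` C) by exact: measurable_aut_image.
pose phi n : partial_iso mu := match n with
  | 0 => pi_of_aut G mC
  | 1 => pi_of_aut (aut_comp (aut_comp U G) (aut_inv U)) mUC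
  | _ => pi_of_aut aut_id (@measurable0 _ T) end.
have dom1 x : pi_dom (phi 1%N) x -> exists2 y, C y & x = U y.
  by move=> [y Cy <-]; exists y.
have rng1 x : pi_rng (phi 1%N) x -> exists2 y, C y & x = U (G y).
  by move=> [_ [y Cy <-] <-]; exists y => //=; rewrite aut_funK.
have rng0 x : pi_rng (phi 0%N) x -> exists2 y, C y & x = G y.
  by move=> [y Cy <-]; exists y.
have domo n x : ~ pi_dom (phi n.+2) x by [].
have rngo n x : ~ pi_rng (phi n.+2) x by move=> [].
have [i j x|i j x|i j x|V VK [Vd Vr Vo]] := @swap_family _ _ _ _ phi.
- case: i j => [|[|i]] [|[|j]]//; try by [move=> /domo|move=> _ /domo].
  + by move=> Cx /dom1[y Cy xE]; case: (Yind (CY _ Cy)); rewrite -xE; exact: CY.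
  + by move=> /dom1[y Cy xE] Cx; case: (Yind (CY _ Cy)); rewrite -xE; exact: CY.
- case: i j => [|[|i]] [|[|j]]//; try by [move=> /rngo|move=> _ /rngo].
  + move=> /rng0[y Cy ->] /rng1[z Cz GE]; case: (Yind (GY _ Cz)).
    by rewrite -GE; exact: GY.
  + move=> /rng1[z Cz ->] /rng0[y Cy GE]; case: (Yind (GY _ Cz)).
    by rewrite GE; exact: GY.
- case: i j => [|[|i]] [|[|j]]//; try by [move=> _ /rngo|move=> /domo].
  + by move=> Cx /rng0[y Cy xE]; apply: (nCG _ Cy); rewrite -xE.
  + by move=> Cx /rng1[y Cy xE]; apply: (Yind (GY _ Cy)); rewrite -xE; exact: CY.
  + by move=> /dom1[y Cy ->] /rng0[z Cz yz]; apply: (Yind (CY _ Cy)); rewrite yz; exact: GY.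
  + move=> /dom1[y Cy ->] /rng1[z Cz /aut_inj yz].
    by apply: (nCG _ Cz); rewrite -yz.
have VC y : C y -> V y = G y by exact: (Vd 0%N).
have VG y : C y -> V (G y) = y by exact: (Vr 0%N).
have VU y : C y -> V (U y) = U (G y).
  move=> Cy; rewrite (Vd 1%N) /=; last by exists y.
  by rewrite aut_funK.
have VUG y : C y -> V (U (G y)) = U y by move=> Cy; rewrite -(VU y Cy) VK.
have Vout x : ~ (C `|` G @` C) x -> ~ (U @` (C `|` G @` C)) x -> V x = x.
  move=> nx nUx; apply: Vo => -[|[|n]]; split=> //.
  - by move=> Cx; apply: nx; left.
  - by move=> /rng0[y Cy xE]; apply: nx; right; exists y.
  - by move=> /dom1[y Cy xE]; apply: nUx; exists y => //; left.
  - move=> /rng1[y Cy xE]; apply: nUx; exists (G y) => //.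
    by right; exists y.
have V1 : L1 V.
  pose f x := dist x (aut_inv U x).
  have mf : measurable_fun setT f by exact: mdisp.
  have mfV : measurable_fun setT (fun x => f (V x)) by exact: measurableT_comp.
  have mk : measurable_fun setT (fun x : T => k%:R%:E : \bar R) by exact: measurable_cst.
  have f0 x : (0 <= f x)%E by exact: dist_ge0.
  have k0 : (0 <= k%:R%:E :> \bar R)%E by rewrite lee_fin.
  apply: (@L1_full_group_dominated _ _ _ _ _ mdist _
    (fun x => f x + (k%:R%:E + f (V x)))%E).
  - by do 2?apply: emeasurable_funD.
  - rewrite ge0_integralD//; last 2 first.
    + by move=> x _; exact: adde_ge0.
    + exact: emeasurable_funD.
    rewrite ge0_integralD// integral_aut// (@integral_cst _ _ _ mu setT)//.
    have /(L1_full_groupP mdist) Ui := L1_inv mdist U1.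
    apply: lte_add_pinfty => //; apply: lte_add_pinfty => //.
    apply: lte_mul_pinfty => //.
    exact: (le_lt_trans (probability_le1 mu measurableT) (ltry 1)).
  apply: aeW => x.
  have sub0 z : (k%:R%:E <= f z + (k%:R%:E + f (V z)))%E.
    by rewrite addeCA; apply: leeDl; apply: adde_ge0.
  have Ubound y : C y -> (dist (U y) (U (G y)) <=
      f (U y) + (k%:R%:E + f (U (G y))))%E.
    move=> Cy; apply: (le_trans (dist_triangle _ y _ _)).
    apply: leeD; first by rewrite /f /= aut_funK.
    apply: (le_trans (dist_triangle _ (G y) _ _)).
    by apply: leeD => //; rewrite /f /= aut_funK dist_sym.
  have [Cx|nC] := pselect (C x); first by apply: le_trans (sub0 x); rewrite VC.
  have [[y Cy <-]|nG] := pselect ((G @` C) x).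
    by apply: le_trans (sub0 _); rewrite VG// dist_sym.
  have [[y [Cy|[z Cz <-]] <-]|nU] := pselect ((U @` (C `|` G @` C)) x).
  - by rewrite VU//; exact: Ubound.
  - by rewrite VUG// dist_sym addeC -addeA addeCA; exact: Ubound.
  have nCGx : ~ (C `|` G @` C) x by move=> [].
  by rewrite (Vout x nCGx nU) dist_refl; apply: adde_ge0 => //; exact: adde_ge0.
exists (aut_comm u V); first by apply: aut_generated_sub; exists u, V.
have commE x : aut_comm u V x = u (V (u (V x))).
  rewrite -[LHS]/(u (V (aut_inv u (aut_inv V x)))).
  by rewrite !aut_inv_invol.
have uG y : C y -> u (G y) = G y.
  move=> Cy; apply: uo; first exact: nCG.
  by move=> [z Cz zE]; apply: (Yind (CY _ Cz)); rewrite zE; exact: GY.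
have uUG y : C y -> u (U (G y)) = U (G y).
  move=> Cy; apply: uo; first by move=> /CY; exact/Yind/GY.
  by move=> [z Cz /aut_inj zE]; apply: (nCG _ Cy); rewrite -zE.
split=> [x [Cx|[y Cy <-]]|x nx nUx]; rewrite !commE.
- rewrite (VC x Cx) (uG x Cx) (VG x Cx) (uC x Cx).1.
  by rewrite (VU x Cx) (uUG x Cx) (VUG x Cx) (uC x Cx).2.
- rewrite (VG y Cy) (uC y Cy).1 (VU y Cy) (uUG y Cy).
  by rewrite (VUG y Cy) (uC y Cy).2 (VC y Cy) (uG y Cy).
have ux : u x = x.
  apply: uo => [Cx|[y Cy yx]]; first by apply: nx; left.
  by apply: nUx; exists y => //; left.
by rewrite (Vout x nx nUx) ux (Vout x nx nUx) ux.
Qed.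
End fundamental_domain.
End involutions_in_derived.

Section halving.
Context {R : realType} {d : measure_display} {T : measurableType d}.
Context {mu : probability T R}.
Variable Phi : set (partial_iso mu).
Implicit Types (S U V W : aut mu) (A C E Y : set T).
Local Notation dist := (graphing_dist Phi).
Local Notation L1 := (L1_full_group Phi).
Local Notation D := (aut_derived L1).
Hypothesis mdist : forall f g : T -> T, measurable_fun setT f ->
  measurable_fun setT g -> measurable_fun setT (fun x => dist (f x) (g x)).
Hint Resolve dist_ge0 measurable_aut_fun : core.
Hypothesis Phi_aperiodic : aperiodic Phi.
Variable B : nat -> set T.
Hypothesis mB : forall k, measurable (B k).
Hypothesis sepB : forall x y, x <> y -> exists k, B k x /\ ~ B k y.
Variables (G : nat -> aut mu) (K : nat -> nat).
Hypothesis GK : forall j x, (dist x (G j x) <= (K j)%:R%:E)%E.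
Hypothesis relG : forall x y, graphing_rel Phi x y -> exists j, G j x = y.

Let Grel j x : graphing_rel Phi x (G j x).
Proof. by apply: dist_lty; exact: le_lt_trans (GK j x) (ltry _). Qed.

(** The points whose [m]-th translate differs from the previous ones form a
    subset [F m] of [A], and the translates [G m @` F m] are pairwise disjoint
    since [A] meets each class at most once.  So the measures of the [F m] are
    summable, while a point with an infinite class belongs to infinitely many
    of them: the lemma of Borel and Cantelli applies. *)
Lemma partial_transversal_null A : measurable A ->
  (forall x y, A x -> A y -> graphing_rel Phi x y -> x = y) -> mu A = 0%E.
Proof.
move=> mA Atr.
pose F m := A `&` \bigcap_(k in `I_m) [set x | G k x <> G m x].
have mF m : measurable (F m).
  apply: measurableI => //; rewrite bigcap_mkcond; apply: bigcapT_measurable => k.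
  by case: ifP => // _; exact: measurable_aut_neq mdist _ _.
have Fsum : (\sum_(m <oo) mu (F m) < +oo)%E.
  rewrite (_ : (\sum_(m <oo) mu (F m) = mu (\bigcup_m (G m @` F m)))%E).
    apply: (@le_lt_trans _ _ 1%E); last exact: ltry.
    apply: probability_le1; apply: bigcupT_measurable => m.
    exact: measurable_aut_image.
  have mGF m : measurable (G m @` F m) by exact: measurable_aut_image.
  rewrite measure_semi_bigcup//; last exact: bigcupT_measurable.
    by apply: eq_eseriesr => m _; exact/esym/measure_aut_image.
  apply/trivIsetP => i j _ _; wlog ij : i j / (i < j)%N => [h ne|_].
    have [ij|ji] : (i < j)%N \/ (j < i)%N by apply/orP; rewrite -neq_ltn.
      exact: h.
    by rewrite setIC; apply: h => //; rewrite eq_sym.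
  apply/seteqP; split=> // z [[x [Ax _] xz] [y [Ay Fy] yz]].
  have xy : x = y.
    apply: Atr => //; apply: (@rst_trans _ _ _ z);
      first by rewrite -xz; exact: Grel.
    by apply: rst_sym; rewrite -yz; exact: Grel.
  by apply: (Fy i ij); rewrite yz -xy.
have lim0 := lim_sup_set_cvg0 mF Fsum.
apply/negligibleP => //; apply: (@negligibleS _ _ _ _
  (lim_sup_set F `|` ~` [set x | infinite_set [set y | graphing_rel Phi x y]])).
  move=> x Ax; have [inf|] := pselect (infinite_set [set y | graphing_rel Phi x y]);
    last by right.
  left=> n _; apply: contrapT => noF; apply: inf.
  apply: (@sub_finite_set _ _ ((fun k => G k x) @` `I_n)); last first.
    exact: finite_image.
  move=> y /relG[j <-]; elim/ltn_ind: j => j IHj.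
  have [jn|nj] := ltnP j n; first by exists j.
  have [k [kj ->]] : exists k, (k < j)%N /\ G j x = G k x.
    apply: contrapT => nok; apply: noF; exists j => //; split=> // k kj jk.
    by apply: nok; exists k.
  exact: IHj.
apply: negligibleU; last exact: Phi_aperiodic.
apply/negligibleP => //.
apply: bigcapT_measurable => n; apply: bigcup_measurable => m _; exact: mF.
Qed.

Section involution.
Variables (U : aut mu) (Y : set T).
Hypothesis U1 : L1 U.
Hypothesis UU : aut_eq (aut_comp U U) aut_id.
Hypothesis mY : measurable Y.
Hypothesis Yind : forall x, Y x -> ~ Y (U x).
Hypothesis Ycov : forall x, U x <> x -> [\/ Y x, Y (U x) | Y (aut_inv U x)].

(** Requiring that [G j] leaves [B k] makes the matched part disjoint from its
    image. *)
Let matched (j k : nat) (Z : set T) : set T :=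
  (Z `&` G j @^-1` Z) `&` (B k `\` G j @^-1` B k).

Let remove (n : nat) (Z : set T) : set T :=
  if choice.unpickle n is Some (j, k) then
    Z `\` (matched j k Z `|` G j @` matched j k Z) else Z.

Fixpoint unmatched (n : nat) : set T :=
  if n is m.+1 then remove m (unmatched m) else Y.

Let mmatched j k Z : measurable Z -> measurable (matched j k Z).
Proof.
move=> mZ; apply: measurableI; first apply: measurableI => //.
  exact: measurable_aut_preimage.
by apply: measurableD => //; exact: measurable_aut_preimage.
Qed.

Lemma measurable_unmatched n : measurable (unmatched n).
Proof.
elim: n => [//|n IHn] /=; rewrite /remove; case: choice.unpickle => [[j k]|//].
apply: measurableD => //; apply: measurableU; first exact: mmatched.
exact/measurable_aut_image/mmatched.
Qed.

Lemma unmatchedS n : unmatched n.+1 `<=` unmatched n.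
Proof.
by rewrite /= /remove => x; case: choice.unpickle => [[j k] []|].
Qed.

Lemma unmatched_sub n : unmatched n `<=` Y.
Proof. by elim: n => [//|n IHn] x /unmatchedS /IHn. Qed.

Lemma derived_swaps n : exists2 W, D W & swaps W U (Y `\` unmatched n).
Proof.
have [D1 DM _ _] : aut_subgroup D by exact: aut_generated_subgroup.
elim: n => [|n [W DW WU]].
  exists aut_id => //; split=> // x [Yx nYx]; by case: nYx.
rewrite /= /remove; case: choice.unpickle => [[j k]|]; last by exists W.
set Z := unmatched n; set C := matched j k Z.
have mC : measurable C by apply: mmatched; exact: measurable_unmatched.
have CZ x : C x -> [/\ Z x, Z (G j x) & ~ C (G j x)].
  by move=> [[Zx ZGx] [Bx nBGx]]; split=> // -[_ []].
have ZY : Z `<=` Y by exact: unmatched_sub.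
have [|W' DW' W'U] := swaps_commutator mdist Yind U1 mC _ (GK j).
  by move=> x /CZ[Zx ZGx nC]; split=> //; exact: ZY.
exists (aut_comp W W'); first exact: DM.
have CGZ : C `|` G j @` C `<=` Z.
  by move=> x [/CZ[]//|[y /CZ[_ ? _] <-]].
apply: eq_swaps (swaps_comp Yind _ _ _ WU W'U).
- move=> x; split=> [[[Yx nZx]|Cx]|[Yx nx]].
  + by split=> // -[].
  + by split; [exact/ZY/CGZ|move=> -[]].
  + have [Zx|nZx] := pselect (Z x); last by left.
    by right; apply: contrapT => nCx; apply: nx.
- by move=> x [].
- by move=> x /CGZ/ZY.
- by move=> x [_ nZx] /CGZ.
Qed.

(** Two distinct equivalent points that survived all the steps would have been
    matched at the step coding some [G j] sending one to the other and some
    [B k] separating them. *)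
Lemma bigcap_unmatched_null : mu (\bigcap_n unmatched n) = 0%E.
Proof.
apply: partial_transversal_null.
  by apply: bigcapT_measurable; exact: measurable_unmatched.
move=> x y Ux Uy /relG[j xy]; apply: contrapT => nxy.
have [k [Bx nBy]] := sepB nxy; pose n := choice.pickle (j, k).
have Cx : matched j k (unmatched n) x.
  split; split=> //; rewrite /preimage /= ?xy//; [exact: Ux|exact: Uy].
have := Ux n.+1 I; rewrite /= /remove choice.pickleK => -[_]; apply; by left.
Qed.

Lemma unmatched_small (e : R) : 0 < e -> exists n, (mu (unmatched n) < e%:E)%E.
Proof.
move=> e0; apply: contrapT => /forallNP big.
have cv : mu \o unmatched @ \oo --> mu (\bigcap_n unmatched n).
  apply: nonincreasing_cvg_mu => //.
  - exact: le_lt_trans (probability_le1 mu (measurable_unmatched 0)) (ltry 1).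
  - exact: measurable_unmatched.
  - by apply: bigcapT_measurable; exact: measurable_unmatched.
  - by apply/nonincreasing_seqP => n; apply/subsetPset; exact: unmatchedS.
have : (e%:E <= mu (\bigcap_n unmatched n))%E.
  rewrite -(cvg_lim _ cv)//; apply: lime_ge.
    by apply/cvg_ex; exists (mu (\bigcap_n unmatched n)).
  by apply: nearW => n /=; rewrite leNgt; apply/negP; exact: big.
by rewrite bigcap_unmatched_null lee_fin leNgt e0.
Qed.

(** Outside the orbits of the unmatched part of the fundamental domain, [W] and
    [U] agree almost everywhere. *)
Lemma swaps_dist n W : swaps W U (Y `\` unmatched n) ->
  {ae mu, forall x, dist (W x) (U x) <=
    ((fun x => dist x (U x)) \_ (unmatched n `|` U @` unmatched n)) x}%E.
Proof.
move=> [WA Wo]; apply: filterS UU => x /= UUx.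
rewrite patchE; case: ifPn => [/set_mem Zx|/negP nZx].
  have -> // : W x = x; apply: Wo; case: Zx => [Zx|[y Zy yx]].
  - by move=> [].
  - by move=> [Yx _]; apply: (Yind (unmatched_sub Zy)); rewrite yx.
  - move=> [y [Yy _] yx]; apply: (Yind Yy); rewrite yx; exact: unmatched_sub Zx.
  - by move=> [z [_ nZz] zx]; apply: nZz; move: zx; rewrite -yx => /aut_inj ->.
have {}nZx : ~ (unmatched n `|` U @` unmatched n) x by move=> ?; apply/nZx/mem_set.
suff -> : W x = U x by rewrite dist_refl.
have [Yx|nYx] := pselect (Y x).
  by apply: (WA x _).1; split=> // Zx; apply: nZx; left.
have [[y Yy yx]|nUY] := pselect ((U @` Y) x).
  have Zy : ~ unmatched n y by move=> Zy; apply: nZx; right; exists y.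
  rewrite -yx (WA y _).2//; apply/esym; apply: (@aut_inj _ _ _ _ U).
  by rewrite yx UUx.
rewrite Wo; last 2 first.
- by move=> [].
- by move=> [y [Yy _] yx]; apply: nUY; exists y.
apply/esym; apply: contrapT => /Ycov[//|YUx|YVx]; apply: nUY.
- by exists (U x).
- by exists (aut_inv U x) => //; exact: aut_ifunK.
Qed.

Lemma involution_in_closure : L1_closure Phi D U.
Proof.
split=> // e e0.
have /(L1_full_groupP mdist) U1' := U1.
have mf : measurable_fun setT (fun x => dist x (U x)).
  by apply: mdist => //; exact: measurable_id.
have [r r0 rP] := integral_small_set mf (fun=> dist_ge0 _ _ _) U1' e0.
have [n nr] : exists n, (mu (unmatched n) < (r / 2)%:E)%E.
  by apply: unmatched_small; lra.
have [W DW WU] := derived_swaps n; exists W => //.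
rewrite L1_dist_sym; have mZ := measurable_unmatched n.
have mE : measurable (unmatched n `|` U @` unmatched n).
  by apply: measurableU => //; exact: measurable_aut_image.
apply: le_lt_trans (rP _ mE _); last first.
  have mUZ := measurable_aut_image U mZ.
  apply: le_lt_trans (measureU2 _ mZ mUZ) _.
  rewrite [r]splitr EFinD; apply: lteD => //.
  by move: nr; congr (_ < _)%E; exact/esym/measure_aut_image.
rewrite [leRHS]integral_mkcond; apply: ae_ge0_le_integral => //.
- exact: mdist.
- by move=> x _; rewrite patchE; case: ifP.
- apply/(measurable_restrictT _ _).1 => //; exact: measurable_funTS.
- by apply: filterS (swaps_dist WU) => x + _.
Qed.
End involution.

Lemma involutions_sub_closure : L1_involutions Phi `<=` L1_closure Phi D.
Proof.
move=> U [U1 UU]; have [Y [mY Yind Ycov]] := maximal_independent U mB sepB.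
exact: involution_in_closure mY Yind Ycov.
Qed.

End halving.

Theorem theorem3p13 (R : realType) (d : measure_display)
  (X : measurableType d) (mu : probability X R)
  (std : standard_probability_space mu)
  (Phi : set (partial_iso mu)) (Phi_graphing : graphing Phi)
  (Phi_aperiodic : aperiodic Phi) :
  L1_closure Phi (aut_derived (L1_full_group Phi)) =
  L1_closure Phi (aut_generated (L1_involutions Phi)).
Proof.
have [B mB sepB] := separating_sets std.1.
have [gen [gen_edge edge_gen]] := generating_involutions std.1 Phi_graphing.
have mdist := measurable_dist gen_edge edge_gen mB sepB.
pose w j := odflt [::] (choice.unpickle j : option (seq nat)).
have relw x y : graphing_rel Phi x y -> exists j, word gen (w j) x = y.
  move=> /(rel_word edge_gen)[v vx]; exists (choice.pickle v).
  by rewrite /w choice.pickleK.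
have D1 := derived_L1 mdist.
apply/seteqP; split.
  exact: L1_closureS (derived_sub_involutions mdist mB sepB).
apply: subset_trans (@L1_closure_idem _ _ _ _ _ mdist _).
apply: L1_closureS; apply: aut_generated_min.
  by apply: L1_closure_subgroup => //; exact: aut_generated_subgroup.
exact: (involutions_sub_closure mdist Phi_aperiodic mB sepB
  (fun j => word_dist gen_edge (w j)) relw).
Qed.
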